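(* Consider the regression model $Y_t=f(t)+\varepsilon_t$, $t\in[0,1]$, with a twice differentiable regression function $f$ and a non-degenerate centered Gaussian error process $\{\varepsilon_t:t\in[0,1]\}$ with triangular covariance kernel $K(s,t)=\mathbb{E}[\varepsilon_s\varepsilon_t]=u(s)v(t)$ for $s\le t$, where the functions $u$ and $v$ are twice differentiable. Let $(\varphi_j)_{j\in\mathbb{N}}$ be an orthonormal basis of $L^2([0,1])$ and $\theta_j=\int_0^1 f(t)\varphi_j(t)\,dt$. Consider the class of all linear estimators $\hat f(t)=\sum_{j=1}^\infty\hat\theta_j\varphi_j(t)$ with $\hat\theta_j=\int_0^1 Y_t\,\xi_j(dt)$, where the $\xi_j$ are signed measures on $[0,1]$ satisfying $$\sum_{j=1}^\infty\Big(\int_0^1 f(t)\,\xi_j(dt)\Big)^2+\sum_{j=1}^\infty\int_0^1\int_0^1 K(s,t)\,\xi_j(ds)\,\xi_j(dt)<\infty .$$ The best linear oracle estimator minimizing the mean integrated squared error $$\mathrm{MISE}(\hat f)=\mathbb{E}\Big[\int_0^1(\hat f(t)-f(t))^2dt\Big]=\sum_{j=1}^\infty\mathbb{E}[(\hat\theta_j-\theta_j)^2]$$ in this class is defined by $$f^*(t)=\sum_{j=1}^\infty\hat\theta_j^*\varphi_j(t),\qquad \hat\theta_j^*=\int_0^1 Y_t\,\xi_j^*(dt),\quad j\in\mathbb{N},$$ where the signed measure $\xi_j^*(dt)$ is the one defined, in each of the three cases (A) $u(0)\neq0$, (B) $u(0)=0,\ f(0)=0$ and (C) $u(0)=0,\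 f(0)\neq0$, in the context. Moreover, the corresponding mean integrated squared error is given by $$\mathrm{MISE}(f^* )=\frac{1}{1+c}\sum_{j=1}^\infty\theta_j^2=\frac{1}{1+c}\int_0^1 f^2(t)\,dt ,$$ where $c$ is defined by $$c=\int_0^1\Big\{\frac{d}{dt}\Big[\frac{f(t)}{v(t)}\Big]\Big\}^2\Big(\frac{d}{dt}q(t)\Big)^{-1}dt+\frac{f^2(0)}{v^2(0)}(q(0))^{-1},\qquad q(t)=\frac{u(t)}{v(t)} .$$
   Context: The functions $u$ and $v$ are known functions on $[0,1]$ with $v(t)\neq0$ for $t\in[0,1]$. The process is non-degenerate on the open interval $(0,1)$, which implies that $q=u/v$ is positive on $(0,1)$ and strictly increasing and continuous on $[0,1]$. $\delta_x$ is the Dirac measure at $x$. Definition of $\xi_j^*$: $\xi_j^*(dt)=\frac{\theta_j}{1+c}\big(P_0\,\delta_0(dt)+P_1\,\delta_1(dt)+p(t)\,dt\big)$, where $c,P_0,P_1,p$ do not depend on $j$ and are as follows. (A) If $u(0)\neq 0$: $$c=\int_0^1\Big\{\frac{d}{dt}\Big[\frac{f(t)}{v(t)}\Big]\Big\}^2\Big(\frac{d}{dt}q(t)\Big)^{-1}dt+\frac{f^2(0)}{v^2(0)}(q(0))^{-1},$$ $$P_0=-\frac{1}{v(0)}\frac{d}{dt}\Big[\frac{f(t)}{u(t)}\Big]\Big|_{t=0}\Big(\frac{d}{dt}q(t)\Big|_{t=0}\Big)^{-1}q(0),\qquad P_1=\frac{1}{u(1)}\frac{d}{dt}\Big[\frac{f(t)}{v(t)}\Big]\Big|_{t=1}\Big(\frac{d}{dt}q(t)\Big|_{t=1}\Big)^{-1}q(1),$$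 $$p(t)=-\frac{1}{v(t)}\frac{d}{dt}\Big\{\frac{d}{dt}\Big[\frac{f(t)}{v(t)}\Big]\Big(\frac{d}{dt}q(t)\Big)^{-1}\Big\}.$$ (B) If $u(0)=0$ and $f(0)=0$: $c=\int_0^1\big\{\frac{d}{dt}\big[\frac{f(t)}{v(t)}\big]\big\}^2\big(\frac{d}{dt}q(t)\big)^{-1}dt$, $P_0=0$, and $P_1$, $p$ are given by the same formulas as in (A). (C) If $u(0)=0$ and $f(0)\neq0$: $c$, $p(t)$ and $P_1$ are equal to zero, and $P_0=\frac{1}{f(0)}$.
   Formalization: It is assumed that q' is nonzero where the formulas divide by it (on [0,1] in case A, on (0,1] in case B), p is integrable on [0,1], the error process is jointly measurable, and in the final c the boundary term is read as +∞ in case C and 0 in case B. *)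

(* Defs.v *)
From HB Require Import structures.
From mathcomp Require Import all_boot all_order all_algebra.
From mathcomp Require Import all_classical all_reals all_analysis.

Set Implicit Arguments.
Unset Strict Implicit.
Unset Printing Implicit Defensive.

Import Order.TTheory GRing.Theory Num.Theory.
Import numFieldNormedType.Exports.

Local Open Scope classical_set_scope.
Local Open Scope ring_scope.

Section Calculus.
Context {R : realType}.
Implicit Types (g : R -> R) (t : R).

(* measurableTypeR R is the instance of the Borel sigma-algebra on R that
   carries lebesgue_measure. *)
Definition I01 : set (measurableTypeR R) := `[0, 1].

Lemma measurable_I01 : measurable I01.
Proof. exact: measurable_itv. Qed.

(* Functions on [0,1] are represented by functions on R whose values outside
   [0,1] are irrelevant: the difference quotient is only taken along points of
   [0,1], so the derivatives at 0 and 1 are the one-sided ones. *)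
Definition quot01 g t := (g s - g t) / (s - t) @[s --> within I01 t^'].

Definition derivable01 g t : Prop := cvg (quot01 g t).

Definition deriv01 g t : R := lim (quot01 g t).

Definition twice_differentiable01 g : Prop :=
  (forall t, I01 t -> derivable01 g t) /\
  (forall t, I01 t -> derivable01 (deriv01 g) t).

End Calculus.

Arguments I01 {R}.

Section L2.
Context {R : realType}.
Notation mu := (@lebesgue_measure R).
Implicit Types (g h : R -> R) (phi : nat -> R -> R).

Definition L2 g : Prop :=
  measurable_fun I01 g /\ (\int[mu]_(t in I01) ((g t) ^+ 2)%:E < +oo)%E.

Definition inner01 g h : R := \int[mu]_(t in I01) (g t * h t).

Definition sqdist01 g h : \bar R :=
  (\int[mu]_(t in I01) ((g t - h t) ^+ 2)%:E)%E.

Definition orthonormal_basis phi : Prop :=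
  [/\ forall j, L2 (phi j),
      forall i j, inner01 (phi i) (phi j) = (i == j)%:R
    & forall h, L2 h ->
        sqdist01 h (fun t => \sum_(j < n) inner01 h (phi j) * phi j t)
          @[n --> \oo] --> 0%E].

End L2.

Section SignedMeasure.
Context {R : realType}.
Notation mu := (@lebesgue_measure R).
Implicit Types (xi : {charge set (measurableTypeR R) -> \bar R}) (g : R -> R).

Definition hahn_pos xi : set R := projT1 (cid (Hahn_decomposition xi)).
Definition hahn_neg xi : set R :=
  projT1 (cid (projT2 (cid (Hahn_decomposition xi)))).
Definition hahn_spec xi : hahn_decomposition xi (hahn_pos xi) (hahn_neg xi) :=
  projT2 (cid (projT2 (cid (Hahn_decomposition xi)))).

(* A signed measure on [0,1] is represented by a charge on R of which only the
   restriction to [0,1] matters, since integrals are taken over [0,1]. *)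
Definition charge_integral xi g : R :=
  \int[jordan_pos (hahn_spec xi)]_(t in I01) g t
  - \int[jordan_neg (hahn_spec xi)]_(t in I01) g t.

Lemma density_integrable g :
  mu.-integrable I01 (EFin \o g) ->
  mu.-integrable [set: measurableTypeR R] ((EFin \o g) \_ I01).
Proof. exact: (integrable_mkcond _ measurable_I01).1. Qed.

Definition density_charge g (ig : mu.-integrable I01 (EFin \o g)) :
    {charge set (measurableTypeR R) -> \bar R} :=
  induced_charge (density_integrable ig).

Definition dirac_charge (a : R) : {charge set (measurableTypeR R) -> \bar R} :=
  charge_of_finite_measure (\d_(a : measurableTypeR R)).

End SignedMeasure.

Section GaussianProcess.
Context {R : realType} {d : measure_display} {T : measurableType d}.
Variable P : probability T R.
Implicit Types (X : T -> R) (eps : R -> {RV P >-> R}).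

(* The library's normal_prob m 0 is a uniform law; here the Gaussian law with
   standard deviation 0 is the Dirac mass, as in the notion of a (possibly
   singular) Gaussian vector. *)
Definition gaussian_law (m s : R) (A : set R) : \bar R :=
  if s == 0 then \d_m A else normal_prob m s A.

Definition gaussian X : Prop :=
  exists m s : R, 0 <= s /\
    forall A : set R, measurable A -> P (X @^-1` A) = gaussian_law m s A.

Definition gaussian_process01 eps : Prop :=
  forall n (t a : 'I_n -> R), (forall i, I01 (t i)) ->
    gaussian (fun w => \sum_(i < n) a i * eps (t i) w).

Definition centered01 eps : Prop := forall t, I01 t -> ('E_P[eps t] = 0)%E.

(* Joint measurability is what makes the pathwise integrals of the process with
   respect to signed measures random variables. *)
Definition jointly_measurable01 (Y : R -> T -> R) : Prop :=
  measurable_fun (I01 `*` [set: T]) (fun x : measurableTypeR R * T => Y x.1 x.2).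

(* The vectors (eps_{t_1},...,eps_{t_n}), with distinct t_i in (0,1), have
   nonsingular covariance matrices. *)
Definition nondegenerate01 eps : Prop :=
  forall n (t : 'I_n -> R), injective t -> (forall i, 0 < t i < 1) ->
    (\matrix_(i < n, j < n) fine (covariance P (eps (t i)) (eps (t j))))
      \in unitmx.

Definition triangular_kernel (u v : R -> R) (s t : R) : R :=
  if s <= t then u s * v t else u t * v s.

Definition has_covariance_kernel01 eps (K : R -> R -> R) : Prop :=
  forall s t, I01 s -> I01 t ->
    ('E_P[(fun w => eps s w * eps t w)%R] = (K s t)%:E)%E.

End GaussianProcess.

Section LinearEstimators.
Context {R : realType} {d : measure_display} {T : measurableType d}.
Variable P : probability T R.
Notation mu := (@lebesgue_measure R).
Variables (f : R -> R) (K : R -> R -> R) (eps : R -> T -> R).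
Variable phi : nat -> R -> R.
Implicit Types (xi : nat -> {charge set (measurableTypeR R) -> \bar R}) (fhat : R -> T -> R).

Definition observation (t : R) (w : T) : R := f t + eps t w.

Definition theta (j : nat) : R := inner01 f (phi j).

Definition theta_hat xi (j : nat) (w : T) : R :=
  charge_integral (xi j) (fun t => observation t w).

Definition admissible xi : Prop :=
  (\sum_(0 <= j <oo) ((charge_integral (xi j) f) ^+ 2)%:E
   + \sum_(0 <= j <oo)
       (charge_integral (xi j)
          (fun t => charge_integral (xi j) (fun s => K s t)))%:E < +oo)%E.

(* fhat is a version of the series with coefficients theta_hat, which
   converges in L^2([0,1]) for almost every outcome. *)
Definition linear_estimator xi fhat : Prop :=
  [/\ admissible xi, jointly_measurable01 fhat &
      {ae P, forall w,
        sqdist01 (fhat ^~ w) (fun t => \sum_(j < n) theta_hat xi j w * phi j t)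
          @[n --> \oo] --> 0%E}].

Definition MISE fhat : \bar R :=
  (\int[P]_w \int[mu]_(t in I01) ((fhat t w - f t) ^+ 2)%:E)%E.

Definition coefficient_risk xi : \bar R :=
  (\sum_(0 <= j <oo) 'E_P[(fun w => (theta_hat xi j w - theta j) ^+ 2)%R])%E.

End LinearEstimators.

Section OracleMeasure.
Context {R : realType}.
Notation mu := (@lebesgue_measure R).
Variables f u v : R -> R.

Definition q (t : R) : R := u t / v t.

Definition f_over_v (t : R) : R := f t / v t.

Definition c_integrand (t : R) : R :=
  (deriv01 f_over_v t) ^+ 2 * (deriv01 q t)^-1.

Definition caseC : bool := (u 0 == 0) && (f 0 != 0).

Definition c_oracle : R :=
  if caseC then 0
  else if u 0 == 0 then \int[mu]_(t in I01) c_integrand t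
  else \int[mu]_(t in I01) c_integrand t + f 0 ^+ 2 / v 0 ^+ 2 * (q 0)^-1.

Definition P0_oracle : R :=
  if caseC then (f 0)^-1
  else if u 0 == 0 then 0
  else - (v 0)^-1 * deriv01 (fun t => f t / u t) 0 * (deriv01 q 0)^-1 * q 0.

Definition P1_oracle : R :=
  if caseC then 0
  else (u 1)^-1 * deriv01 f_over_v 1 * (deriv01 q 1)^-1 * q 1.

Definition p_oracle (t : R) : R :=
  if caseC then 0
  else - (v t)^-1 * deriv01 (fun s => deriv01 f_over_v s * (deriv01 q s)^-1) t.

(* The derivative q' is nonnegative because q is increasing, but it may vanish,
   whereas the formulas above divide by it: on [0,1] if u 0 != 0, and on (0,1]
   (up to a null set) if u 0 = f 0 = 0. *)
Definition oracle_well_defined : Prop :=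
  (u 0 != 0 -> deriv01 q 0 != 0) /\
  (~~ caseC -> forall t, 0 < t <= 1 -> deriv01 q t != 0).

Definition xi_oracle (th : nat -> R)
    (ip : mu.-integrable I01 (EFin \o p_oracle)) (j : nat) :
    {charge set (measurableTypeR R) -> \bar R} :=
  cscale (th j / (1 + c_oracle))
    (cadd (cadd (cscale P0_oracle (dirac_charge 0))
                (cscale P1_oracle (dirac_charge 1)))
          (density_charge ip)).

(* In the extended reals 0^-1 = +oo and 0 * +oo = 0: this is c_oracle if
   u 0 != 0 or f 0 = 0, and it is +oo if u 0 = 0 and f 0 != 0, where
   (1 + c)^-1 = 0 although c_oracle is 0. *)
Definition c_mise : \bar R :=
  (\int[mu]_(t in I01) (c_integrand t)%:E
   + (f 0 ^+ 2 / v 0 ^+ 2)%:E * ((q 0)%:E)^-1)%E.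

End OracleMeasure.

(* Main.v *)
Require Import Defs.
From HB Require Import structures.
From mathcomp Require Import all_boot all_order all_algebra.
From mathcomp Require Import all_classical all_reals all_analysis.
From mathcomp Require Import measurable_realfun ring lra.

(** Fix a coordinate and a signed measure [xi]. The statistic [\int Y dxi]
    estimates [theta_j] with squared bias [(\int f dxi - theta_j)^2] and with
    variance [\int \int K dxi dxi], and by Fubini's theorem the noises of two such
    statistics [xi], [nu] have covariance [\int (\int K(s, t) nu(ds)) xi(dt)]
    ([covariance_noise]). Suppose that [nu] solves the integral equation
    [\int K(s, t) nu(ds) = f(t)] on [0,1], and let [c = \int f dnu]. Then the
    covariance with [nu] is the mean [\int f dxi] and the variance of [nu] is [c].
    Nonnegativity of the variance of the noise of [xi - la nu], for
    [la = theta_j / (1 + c)], bounds the risk of [xi] below by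
    [theta_j^2 / (1 + c)], and [xi = la nu] attains the bound
    ([estimation_risk_ge]). The same [nu] thus serves all coordinates.

    What remains of the optimality is to solve the integral equation. With
    [q = u / v], [F = f / v] and [h = F' / q'] the kernel is
    [v(s) v(t) q(min(s, t))], and integration by parts shows that the measure with
    density [- h' / v] and with suitable atoms at 0 and 1 is a solution whose [c]
    is the constant of the theorem ([oracle_kernel_equation],
    [oracle_integral_f]). The functions are only twice differentiable, so [h'] is
    merely an everywhere defined, integrable derivative, without any continuity;
    the integration by parts rests on the fundamental theorem of calculus for such
    functions ([integral_derive]), which is proved here by a growth estimate
    against a lower semicontinuous majorant. If [u(0) = 0] and [f(0) = 0], the
    derivative of [q] may vanish at 0 and [h] has to be replaced there by its limit.
    If [u(0) = 0] and [f(0) <> 0], the equation has no such solution, but then the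
    process has variance 0 at time 0: the atom at 0 recovers every [theta_j]
    exactly, and the risk is 0.

    The coordinates are put together by Parseval's identity, applied for almost
    every outcome: the integrated squared error of an estimator is the sum of the
    risks of its coefficients ([MISE_eq_coefficient_risk]). The coefficients of the
    oracle are all multiples of a single random variable, so its series sums to a
    random multiple of [f] ([exists_scaled_estimator]). *)

Set Implicit Arguments.
Unset Strict Implicit.
Unset Printing Implicit Defensive.

Import Order.TTheory GRing.Theory Num.Theory.
Import numFieldNormedType.Exports.

Local Open Scope classical_set_scope.
Local Open Scope ring_scope.

(** * Everywhere differentiable functions with integrable derivative *)

(** Continuous induction along a segment: used to propagate a local growth
    estimate, whose scale depends on the point in no uniform way, from one end of
    the segment to the other. *)
Lemma real_induction (R : realType) (a b : R) (Q : R -> Prop) :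
  a <= b -> Q a ->
  (forall x, a <= x < b -> Q x ->
     exists2 d : R, 0 < d & forall y, x < y < x + d -> y <= b -> Q y) ->
  (forall x, a < x <= b -> (forall y, a <= y < x -> Q y) -> Q x) ->
  Q b.
Proof.
move=> ab Qa Qr Ql.
pose S := [set x | a <= x <= b /\ forall y, a <= y <= x -> Q y].
have Sa : S a.
  split; first by rewrite lexx ab.
  by move=> y /andP[ay ya]; have -> : y = a by apply/eqP; rewrite eq_le ay ya.
have hS : has_sup S by split; [exists a|exists b => x [/andP[]]].
pose s := sup S.
have as_ : a <= s by apply: ub_le_sup => //; case: hS.
have sb : s <= b by apply: ge_sup; [exists a|move=> x [/andP[]]].
have Qlt y : a <= y < s -> Q y.
  move=> /andP[ay ys].
  have [x [_ Sx] yx] : exists2 x, S x & y < x by apply: sup_gt => //; exists a.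
  by apply: Sx; rewrite ay ltW.
have Qs : Q s.
  move: as_; rewrite le_eqVlt => /predU1P[<-//|as_].
  by apply: Ql => //; rewrite as_ sb.
move: (sb); rewrite le_eqVlt => /predU1P[<-//|sltb].
have [d d0 Qd] : exists2 d : R, 0 < d & forall y, s < y < s + d -> y <= b -> Q y.
  by apply: Qr => //; rewrite as_ sltb.
pose y := Num.min b (s + d / 2).
have sy : s < y by rewrite lt_min sltb /= ltrDl divr_gt0.
have : S y.
  split; first by rewrite (le_trans as_ (ltW sy)) /= ge_min lexx.
  move=> z /andP[az zy]; have [zs|sz|->] := ltgtP z s => //.
    by apply: Qlt; rewrite az.
  apply: Qd; rewrite ?sz /=; last by rewrite (le_trans zy)// ge_min lexx.
  rewrite (le_lt_trans zy)// gt_min; apply/orP; right.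
  by rewrite ltrD2l ltr_pdivrMr// ltr_pMr// ltr1n.
move/(ub_le_sup (proj2 hS)); rewrite -/s leNgt sy //.
Qed.

Section majorant.
Context {R : realType}.
Notation mu := (@lebesgue_measure R).

(** A form of the Vitali-Caratheodory theorem. Slice [D] into the level sets
    [E n] where [`|g|] lies between two consecutive multiples of [e / 2], enclose
    each in an open set [U n] of almost the same measure, and give [U n] the
    weight of a number slightly above the upper level: near a point of [E n] the
    resulting function stays above a constant exceeding [`|g x|]. *)
Lemma lower_semicontinuous_majorant (D : set (measurableTypeR R))
    (g : R -> R) (e : R) :
  measurable D -> (mu D < +oo)%E -> measurable_fun D g -> 0 < e ->
  exists w : measurableTypeR R -> \bar R,
    [/\ measurable_fun [set: measurableTypeR R] w, forall x, (0 <= w x)%E,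
        (\int[mu]_(x in D) w x <= \int[mu]_(x in D) (`|g x| + e)%:E + e%:E)%E &
        forall x, D x -> exists k d : R, [/\ `|g x| < k, 0 < d &
          forall y, `|x - y| < d -> (k%:E <= w y)%E]].
Proof.
move=> mD Dfin mg e0'.
pose e1 := e / 2; have e0 : 0 < e1 by rewrite divr_gt0.
pose E n : set (measurableTypeR R) := D `&` (fun x => `|g x|) @^-1` `[n%:R * e1, n.+1%:R * e1[.
have mE n : measurable (E n).
  have : measurable_fun D (fun x => `|g x|) by exact: measurableT_comp.
  by apply => //; exact: measurable_itv.
have muE n : (mu (E n) < +oo)%E.
  apply: (le_lt_trans _ Dfin); apply: le_measure; rewrite ?inE//.
  exact: subIsetl.
(* chosen so that the excess measure of U n costs e / 2 ^ n.+1 *)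
pose dl n : R := e / (2 ^ n.+1)%:R / (n.+1%:R * e1 + e1).
have k0 n : 0 < n.+1%:R * e1 + e1 by rewrite addr_gt0// mulr_gt0.
have dl0 n : 0 < dl n by rewrite !divr_gt0// ltr0n expn_gt0.
have /choice[U HU] n := lebesgue_regularity_outer (mE n) (muE n) (dl0 n).
have oU n : open (U n) by case: (HU n).
have mU n : measurable (U n : set (measurableTypeR R)) by exact: open_measurable.
have EU n : E n `<=` U n by case: (HU n).
have UE n : (mu (U n) <= mu (E n) + (dl n)%:E)%E.
  have -> : U n = E n `|` (U n `\` E n) by rewrite setDUK//.
  rewrite measureU//; [|exact: measurableD|by rewrite setDIK].
  by rewrite leeD2l// ltW//; case: (HU n).
have DE : D = \bigcup_n E n.
  apply/seteqP; split; last by move=> x [n _ []].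
  move=> x Dx; exists (Num.truncn (`|g x| / e1)) => //; split => //=.
  have /truncn_itv : 0 <= `|g x| / e1 by rewrite divr_ge0// ltW.
  by rewrite in_itv/= ler_pdivlMr// ltr_pdivrMr.
pose k n : R := n.+1%:R * e1 + e1.
pose w (x : measurableTypeR R) : \bar R := (\sum_(0 <= n <oo) ((k n)%:E * (\1_(U n) x)%:E))%E.
have mt n : measurable_fun [set: measurableTypeR R] (fun x => (k n)%:E * (\1_(U n) x)%:E)%E.
  by apply: measurable_funeM; apply/measurable_EFinP.
have t0 n x : (0 <= (k n)%:E * (\1_(U n) x)%:E)%E.
  by rewrite mule_ge0// lee_fin// ltW// k0.
exists w; split.
- by apply: ge0_emeasurable_sum => // n x _ _; exact: t0.
- by move=> x; apply: nneseries_ge0 => n _ _; exact: t0.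
- rewrite integral_nneseries//; last by move=> n; exact: measurable_funTS.
  have -> : (\int[mu]_(x in D) (`|g x| + e)%:E =
     \sum_(0 <= n <oo) \int[mu]_(x in E n) (`|g x| + e)%:E)%E.
    rewrite [in LHS]DE ge0_integral_bigcup//.
    - rewrite -DE; apply/measurable_EFinP/measurable_funD => //.
      exact: measurableT_comp.
    - by move=> x _; rewrite lee_fin addr_ge0// ltW.
    - apply/trivIsetP => i j _ _ ij; rewrite -subset0 => x [[_ Ei] [_ Ej]] /=.
      move: Ei Ej; rewrite /= !in_itv/= => /andP[i1 i2] /andP[j1 j2].
      have := le_lt_trans i1 j2; have := le_lt_trans j1 i2.
      rewrite !ltr_pM2r// !ltr_nat !ltnS => ji ij'.
      by move: ij; rewrite eqn_leq ji ij'.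
  apply: (le_trans _ (epsilon_trick xpredT _ (ltW e0'))) => [|n]; last first.
    by apply: integral_ge0 => x _; rewrite lee_fin addr_ge0// ltW.
  apply: lee_nneseries => [n _ _|n _].
    by apply: integral_ge0 => x _; exact: t0.
  rewrite ge0_integralZl//; last 2 first.
  + by apply/measurable_EFinP; exact: measurable_funTS.
  + by rewrite lee_fin ltW// k0.
  rewrite integral_indic//.
  apply: (@le_trans _ _ ((k n)%:E * (mu (E n) + (dl n)%:E))%E).
    apply: lee_wpmul2l; first by rewrite lee_fin ltW// k0.
    apply: (le_trans _ (UE n)).
    by apply: le_measure; rewrite ?inE//; exact: measurableI.
  rewrite ge0_muleDr; [|exact: measure_ge0|by rewrite lee_fin ltW].
  apply: leeD.
    rewrite -integral_cst//; apply: ge0_le_integral => //.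
    + by move=> x _; rewrite lee_fin ltW// k0.
    + apply/measurable_EFinP; apply: measurable_funD => //.
      apply: measurableT_comp => //; apply: measurable_funS mg => //.
      exact: subIsetl.
    + move=> x [_]; rewrite /= in_itv/= lee_fin /k => /andP[ng _].
      by rewrite -natr1 /e1 in ng *; lra.
  rewrite -EFinM lee_fin /dl mulrCA mulfV ?mulr1//.
  exact: lt0r_neq0 (k0 n).
- move=> x; rewrite {1}DE => -[n _ Enx]; exists (k n).
  have /nbhs_ballP[d /= d0 dU] : nbhs x (U n).
    by apply: open_nbhs_nbhs; split => //; exact: EU.
  exists d; split => //.
    by case: Enx => _; rewrite /= in_itv/= => /andP[_ h]; rewrite /k; lra.
  move=> y xy; rewrite /w (@nneseriesD1 _ _ n)//.
  rewrite indicE mem_set ?mule1; last exact: dU.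
  by rewrite leeDl// nneseries_ge0// => i _ _; exact: t0.
Qed.

Lemma is_derive_lipschitz_near (h : R -> R) (x l k : R) :
  is_derive x 1 h l -> `|l| < k ->
  exists2 d : R, 0 < d & forall y, `|y - x| < d -> `|h y - h x| <= k * `|y - x|.
Proof.
move=> [dh hl] lk.
have e0 : 0 < k - `|l| by rewrite subr_gt0.
have : z^-1 *: ((h \o shift x) (z *: (1 : R)) - h x) @[z --> 0^'] --> l.
  by rewrite -hl; exact: dh.
move=> /cvgrPdist_lt/(_ _ e0)[d /= d0 hd]; exists d => // y yx.
have [->|ynx] := eqVneq y x; first by rewrite !subrr normr0 mulr0.
have yx0 : y - x != 0 by rewrite subr_eq0.
have := hd (y - x); rewrite /= sub0r normrN => /(_ yx yx0).
rewrite [(y - x)%:A]mulr1 subrK /GRing.scale/= => hyx.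
have : `|(y - x)^-1 * (h y - h x)| < k.
  rewrite -[X in `|X|](subrK l) (le_lt_trans (ler_normD _ _))//.
  by rewrite -ltrBrDr distrC.
rewrite normrM normfV mulrC ltr_pdivrMr ?normr_gt0//.
exact: ltW.
Qed.

(** With [w] a majorant of [`|g|] as above, [\int w] grows over a short interval
    to the right of [x] at least as fast as [h] does, because [w] is bounded below
    near [x] by a constant larger than [`|g x|]. Continuous induction then bounds the
    increment of [h] by that of the integral. *)
Lemma normB_le_integral_derive_closed (h g : R -> R) (a b : R) :
  a <= b -> (forall x, a <= x <= b -> is_derive x 1 h (g x)) ->
  measurable_fun (`[a, b] : set (measurableTypeR R)) g ->
  (`|h b - h a|%:E <= \int[mu]_(t in `[a, b]) `|g t|%:E)%E.
Proof.
move=> ab dh mg; apply/lee_addgt0Pr => e e0.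
pose D : set (measurableTypeR R) := `[a, b]%classic.
have mD : measurable D by exact: measurable_itv.
have muD : mu D = (b - a)%:E.
  by rewrite lebesgue_measure_itv/= lte_fin -EFinB; case: ltgtP ab => // ->; rewrite subrr.
pose e1 := e / (b - a + 1).
have ba0 : 0 < b - a + 1 by lra.
have e10 : 0 < e1 by rewrite divr_gt0.
have [|w [mw w0 wint wmaj]] := lower_semicontinuous_majorant mD _ mg e10.
  by rewrite muD ltry.
apply: (@le_trans _ _ (\int[mu]_(x in D) w x)%E); last first.
  apply: (le_trans wint).
  under eq_integral do rewrite EFinD.
  rewrite ge0_integralD//; last 2 first.
  - by apply/measurable_EFinP; exact: measurableT_comp.
  - by move=> x _; rewrite lee_fin ltW.
  rewrite integral_cst// [X in (_ + _ * X)%E]muD -addeA leeD2l// -EFinM -EFinD lee_fin.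
  by rewrite -[X in _ + X]mulr1 -mulrDr /e1 mulfVK// gt_eqF.
pose Q x := (`|h x - h a|%:E <= \int[mu]_(t in `[a, x]) w t)%E.
apply: (@real_induction R a b Q) => //.
- by rewrite /Q subrr normr0 integral_ge0.
- move=> x /andP[ax xb] Qx.
  have Dx : D x by rewrite /D/= in_itv/= ax ltW.
  have [k [d [gk d0 wk]]] := wmaj x Dx.
  have [|d2 d20 hd2] := is_derive_lipschitz_near (dh x _) gk.
    by rewrite ax ltW.
  exists (Num.min d d2); first by rewrite lt_min d0.
  move=> y /andP[xy yd] yb; rewrite /Q.
  have yxd : `|y - x| < Num.min d d2 by rewrite gtr0_norm ?subr_gt0// ltrBlDl.
  rewrite (@itv_bndbnd_setU _ _ _ (BRight x)) ?bnd_simp//; last exact: ltW.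
  rewrite ge0_integral_setU//; last 2 first.
  - exact: measurable_funTS.
  - apply/disj_setPS => z [/=]; rewrite 2!in_itv/= => /andP[_ zx] /andP[].
    by rewrite ltNge zx.
  have yx : 0 <= y - x by rewrite subr_ge0 ltW.
  apply: (@le_trans _ _ (`|h x - h a| + k * (y - x))%:E).
    rewrite lee_fin -[h y - h a](subrKA (h x)) addrC (le_trans (ler_normD _ _))//.
    rewrite lerD2l -[X in _ * X]ger0_norm//; apply: hd2.
    by rewrite (lt_le_trans yxd)// ge_min lexx orbT.
  rewrite EFinD; apply: leeD => //.
  have -> : (k * (y - x))%:E = (\int[mu]_(z in `]x, y]) cst k%:E z)%E.
    have mxy : mu `]x, y] = (y - x)%:E by rewrite lebesgue_measure_itv/= lte_fin xy.
    by rewrite integral_cst//= [X in (_ * X)%E]mxy.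
  apply: ge0_le_integral => //.
  - by move=> z _; rewrite lee_fin (le_trans _ (ltW gk)).
  - exact: measurable_funTS.
  - move=> z; rewrite /= in_itv/= => /andP[xz zy]; apply: wk.
    rewrite distrC gtr0_norm ?subr_gt0//.
    rewrite (@le_lt_trans _ _ (y - x)) ?lerD2r//.
    by rewrite -[y - x]ger0_norm// (lt_le_trans yxd)// ge_min lexx.
- move=> x /andP[ax xb] Qy; apply/lee_addgt0Pr => e' e'0.
  have dhx : is_derive x 1 h (g x) by apply: dh; rewrite (ltW ax).
  have gk : `|g x| < `|g x| + 1 by rewrite ltrDl.
  have [d d0 hd] := is_derive_lipschitz_near dhx gk.
  pose k := `|g x| + 1; have k0 : 0 < k by rewrite ltr_wpDl.
  pose r := Num.min (Num.min (d / 2) (e' / k)) (x - a).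
  have r0 : 0 < r by rewrite !lt_min !divr_gt0//= subr_gt0.
  have rd : r < d.
    apply: (@le_lt_trans _ _ (d / 2)); last by lra.
    by rewrite !ge_min lexx.
  have re : k * r <= e'.
    by rewrite mulrC -ler_pdivlMr// !ge_min lexx orbT.
  have ra : r <= x - a by rewrite ge_min lexx orbT.
  have Qxr : Q (x - r) by apply: Qy; apply/andP; split; lra.
  apply: (@le_trans _ _ (`|h (x - r) - h a| + e')%:E).
    rewrite lee_fin -[h x - h a](subrKA (h (x - r))) addrC.
    rewrite (le_trans (ler_normD _ _))// lerD2l distrC.
    rewrite (le_trans _ re)//.
    have xr : `|x - r - x| = r by rewrite addrC addKr normrN gtr0_norm.
    by have := hd (x - r); rewrite xr; exact.
  rewrite EFinD leeD2r// (le_trans Qxr)//.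
  apply: ge0_subset_integral => //.
  - exact: measurable_funTS.
  - by apply: subset_itvl; rewrite bnd_simp lerBlDr lerDl ltW.
Qed.
End majorant.

Section FTC.
Context {R : realType}.
Notation mu := (@lebesgue_measure R).

Lemma normB_le_integral_derive (h g : R -> R) (a b : R) :
  a < b -> {within `[a, b], continuous h} ->
  (forall x, a < x < b -> is_derive x 1 h (g x)) ->
  measurable_fun (`[a, b] : set (measurableTypeR R)) g ->
  (`|h b - h a|%:E <= \int[mu]_(t in `[a, b]) `|g t|%:E)%E.
Proof.
move=> ab ch dh mg; apply/lee_addgt0Pr => e e0.
have [_ ha hb] := (continuous_within_itvP _ ab).1 ch.
have e20 : 0 < e / 2 by rewrite divr_gt0.
have [x [hx /andP[ax xm]]] : exists x, `|h a - h x| < e / 2 /\ a < x < (a + b) / 2.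
  apply: (@filter_ex _ a^'+); near=> x; split.
    by near: x; move/cvgrPdist_lt : ha => /(_ _ e20).
  by apply/andP; split => //; near: x; apply: nbhs_right_lt; lra.
have [y [hy /andP[my yb]]] : exists y, `|h b - h y| < e / 2 /\ (a + b) / 2 < y < b.
  apply: (@filter_ex _ b^'-); near=> y; split.
    by near: y; move/cvgrPdist_lt : hb => /(_ _ e20).
  by apply/andP; split => //; near: y; apply: nbhs_left_gt; lra.
have sub : `[x, y] `<=` (`[a, b] : set (measurableTypeR R)).
  by move=> z; rewrite /= !in_itv/= => /andP[? ?]; apply/andP; split; lra.
have hxy : (`|h y - h x|%:E <= \int[mu]_(t in `[x, y]) `|g t|%:E)%E.
  apply: normB_le_integral_derive_closed.
  - by rewrite ltW// (lt_trans xm).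
  - by move=> z /andP[xz zy]; apply: dh; apply/andP; split; lra.
  - exact: measurable_funS mg.
apply: (@le_trans _ _ (`|h y - h x| + e)%:E); last first.
  rewrite EFinD leeD2r// (le_trans hxy)//; apply: ge0_subset_integral => //.
  by apply/measurable_EFinP; exact: measurableT_comp.
rewrite lee_fin -[h b - h a](subrKA (h y)) -[h y - h a](subrKA (h x)).
rewrite (le_trans (ler_normD _ _))// addrC.
have := ler_normD (h y - h x) (h x - h a); rewrite (distrC (h x)); lra.
Unshelve. all: by end_near. Qed.

(** Subtract from [h] a primitive [C] of a continuous function [c] that is close
    to [g] in L1. The difference has derivative [g - c], so by the previous
    estimate its increment is at most the L1-distance of [g] and [c]; the classical
    theorem for [c] and that same distance give the claim up to an arbitrarily
    small error. *)
Theorem integral_derive (h g : R -> R) (a b : R) :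
  a <= b -> {within `[a, b], continuous h} ->
  (forall x, a < x < b -> is_derive x 1 h (g x)) ->
  mu.-integrable `[a, b] (EFin \o g) ->
  \int[mu]_(t in `[a, b]) g t = h b - h a.
Proof.
rewrite le_eqVlt => /predU1P[<- _ _ _|ab ch dh ig].
  by rewrite set_itv1 Rintegral_set1 subrr.
have mab : measurable (`[a, b] : set (measurableTypeR R)) by exact: measurable_itv.
have fab : (mu `[a, b] < +oo)%E by rewrite lebesgue_measure_itv/= lte_fin ab -EFinB ltry.
have [c_ [cc ic cvgc]] := approximation_continuous_integrable mab fab ig.
apply/eqP; rewrite -subr_eq0 -normr_le0; apply/ler_addgt0Pr => e e0; rewrite add0r.
have e20 : (0 < (e / 2)%:E)%E by rewrite lte_fin divr_gt0.
have [n cn] : exists n, (\int[mu]_(z in `[a, b]) `|(g z - c_ n z)%:E| < (e / 2)%:E)%E.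
  apply: (@filter_ex _ \oo).
  have : nbhs (0 : \bar R) [set y | (y < (e / 2)%:E)%E].
    by apply: open_nbhs_nbhs; split => //; exact: open_ereal_lt_ereal.
  by move/cvgc.
pose c := c_ n; pose C x := \int[mu]_(t in `[a, x]) c t.
have Ca : C a = 0 by rewrite /C set_itv1 Rintegral_set1.
have igc : mu.-integrable `[a, b] (EFin \o (fun t => g t - c t)).
  exact: (integrableB mab ig (ic n)).
have bound : (`|(h b - C b) - (h a - C a)|%:E <= \int[mu]_(t in `[a, b]) `|g t - c t|%:E)%E.
  apply: (@normB_le_integral_derive (h \- C)) => //.
  - move=> x; apply: cvgB; first exact: ch.
    exact: (parameterized_integral_continuous (ltW ab) (ic n)).
  - move=> x /andP[ax xb]; apply: is_deriveB; first by apply: dh; rewrite ax.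
    have [dC C'] := continuous_FTC1_closed xb (ic n) ax (cc n x).
    apply: DeriveDef; first exact: dC.
    rewrite -derive1E; exact: C'.
  - apply/measurable_EFinP.
    exact: (measurable_int mu igc).
have boundC : (`|C b - \int[mu]_(t in `[a, b]) g t|%:E <= \int[mu]_(t in `[a, b]) `|g t - c t|%:E)%E.
  rewrite distrC /C -RintegralB//; last exact: ic.
  rewrite EFin_normr_Rintegral//.
  by apply: le_abse_integral => //; exact: measurable_int igc.
have N : (\int[mu]_(t in `[a, b]) `|g t - c t|%:E <= (e / 2)%:E)%E by exact: ltW.
have {N} := (le_trans bound N, le_trans boundC N).
rewrite !lee_fin Ca subr0 => -[b1 b2].
rewrite distrC.
have := ler_normD (h b - C b - h a) (C b - \int[mu]_(t in `[a, b]) g t).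
rewrite addrA (_ : _ - _ + C b = h b - h a); last by ring.
by lra.
Qed.
End FTC.

(** * Derivatives relative to the unit interval *)

Section deriv01_theory.
Context {R : realType}.
Implicit Types (g h : R -> R) (t l : R).

(** The quotients defining [deriv01] are taken along a punctured neighbourhood
    inside [0,1], so that the rules of calculus hold at the endpoints too. *)
Definition is_deriv01 g t l := quot01 g t --> l.

Lemma I01P t : I01 t <-> 0 <= t <= 1.
Proof. by rewrite /I01/= in_itv. Qed.

(** Properness is what makes one-sided limits at 0 and 1 unique. *)
Lemma within_I01_proper t : I01 t -> ProperFilter (within I01 t^').
Proof.
move=> /I01P /andP[t0 t1]; split; last exact: within_filter.
rewrite /within /= => /nbhs_ballP[d /= d0 hd].
have d2 : 0 < d / 2 by rewrite divr_gt0.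
have [t1'|t1'] := ltP t 1.
- pose r := Num.min (d / 2) (1 - t).
  have r0 : 0 < r by rewrite lt_min d2 subr_gt0.
  have rd : r <= d / 2 by rewrite ge_min lexx.
  have rt : r <= 1 - t by rewrite ge_min lexx orbT.
  apply: (hd (t + r)).
  + by rewrite /ball/= opprD addNKr normrN gtr0_norm//; lra.
  + by rewrite -subr_eq0 addrC addKr gt_eqF.
  + by apply/I01P/andP; split; lra.
- pose r := Num.min (d / 2) 1.
  have r0 : 0 < r by rewrite lt_min d2 ltr01.
  have rd : r <= d / 2 by rewrite ge_min lexx.
  have rt : r <= 1 by rewrite ge_min lexx orbT.
  apply: (hd (t - r)).
  + by rewrite /ball/= subKr gtr0_norm//; lra.
  + by rewrite -subr_eq0 addrC addKr oppr_eq0 gt_eqF.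
  + by apply/I01P/andP; split; lra.
Qed.

Lemma within_I01_neq t : \forall s \near within I01 t^', s != t.
Proof. by rewrite /within/=; apply: (@filterS _ (nbhs t) _ setT) filterT => s. Qed.

Lemma derivable01P g t : derivable01 g t <-> is_deriv01 g t (deriv01 g t).
Proof. by []. Qed.

Lemma is_deriv01E g t l : I01 t -> is_deriv01 g t l -> deriv01 g t = l.
Proof.
move=> It gl; have := within_I01_proper It => ?.
exact: cvg_lim.
Qed.

Lemma is_deriv01_derivable g t l : is_deriv01 g t l -> derivable01 g t.
Proof. by move=> gl; apply/cvg_ex; exists l. Qed.

Lemma eq_is_deriv01 g h t l : I01 t -> (forall s, I01 s -> g s = h s) ->
  is_deriv01 g t l -> is_deriv01 h t l.
Proof.
move=> It gh; apply: cvg_trans; apply: near_eq_cvg.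
near=> s; rewrite !gh//; near: s; exact: withinT.
Unshelve. all: by end_near. Qed.

Lemma is_deriv01_continuous g t l : is_deriv01 g t l ->
  g s @[s --> within I01 t^'] --> g t.
Proof.
move=> gl.
have st : s - t @[s --> within I01 t^'] --> t - t.
  apply: cvgB; last exact: cvg_cst.
  by move=> U tU; apply: filterS tU => s Us _ _.
rewrite -[X in _ --> X]addr0 -[X in _ --> _ + X](mul0r l) -(subrr t).
have : g t + (s - t) * ((g s - g t) / (s - t)) @[s --> within I01 t^'] -->
    g t + (t - t) * l.
  by apply: cvgD; [exact: cvg_cst|exact: cvgM].
apply: cvg_trans; apply: near_eq_cvg.
near=> s; have st' : s != t by near: s; exact: within_I01_neq.
by rewrite mulrC mulfVK ?subr_eq0// subrKC.
Unshelve. all: by end_near. Qed.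

Lemma is_deriv01_within_continuous g (l : R -> R) (a b : R) : 0 <= a -> b <= 1 ->
  (forall t, a <= t <= b -> is_deriv01 g t (l t)) -> {within `[a, b], continuous g}.
Proof.
move=> a0 b1 gl; apply/subspace_continuousP => t /=; rewrite in_itv/= => tab.
move=> U gU; have := is_deriv01_continuous (gl t tab) gU.
apply: (@filterS _ (nbhs t)) => s Us; rewrite /= in_itv/= => /andP[as_ sb].
have [->|st] := eqVneq s t; first exact: nbhs_singleton gU.
by apply: Us => //; apply/I01P/andP; split; lra.
Qed.

Lemma is_deriv01_cst (c : R) t : is_deriv01 (cst c) t 0.
Proof.
rewrite /is_deriv01 /quot01 (_ : (fun s => _) = cst 0); first exact: cvg_cst.
by apply/funext => s; rewrite subrr mul0r.
Qed.

Lemma is_deriv01B g h t lg lh : is_deriv01 g t lg -> is_deriv01 h t lh ->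
  is_deriv01 (fun s => g s - h s) t (lg - lh).
Proof.
move=> gl hl.
rewrite /is_deriv01 /quot01.
rewrite (_ : (fun s => _) = fun s => (g s - g t) / (s - t) - (h s - h t) / (s - t)).
  exact: cvgB.
by apply/funext => s; rewrite -mulrBl; congr (_ / _); ring.
Qed.

Lemma is_deriv01M g h t lg lh : is_deriv01 g t lg -> is_deriv01 h t lh ->
  is_deriv01 (fun s => g s * h s) t (lg * h t + g t * lh).
Proof.
move=> gl hl.
rewrite /is_deriv01 /quot01.
rewrite (_ : (fun s => _) = fun s => (g s - g t) / (s - t) * h s + g t * ((h s - h t) / (s - t))).
  apply: cvgD.
    by apply: cvgM => //; exact: is_deriv01_continuous hl.
  by apply: cvgM => //; exact: cvg_cst.
by apply/funext => s; ring.
Qed.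

Lemma is_deriv01V g t l : I01 t -> g t != 0 -> is_deriv01 g t l ->
  is_deriv01 (fun s => (g s)^-1) t (- l / g t ^+ 2).
Proof.
move=> It gt0 gl; rewrite /is_deriv01 /quot01.
have gc := is_deriv01_continuous gl.
have : - ((g s - g t) / (s - t)) * ((g s)^-1 * (g t)^-1) @[s --> within I01 t^'] -->
    - l * ((g t)^-1 * (g t)^-1).
  apply: cvgM; first exact: cvgN.
  by apply: cvgM; [exact: cvgV|exact: cvg_cst].
rewrite expr2 invfM; apply: cvg_trans; apply: near_eq_cvg.
near=> s.
have gs0 : g s != 0.
  near: s; move: gc => /(_ [set y | y != 0]); apply.
  by apply: open_nbhs_nbhs; split => //; exact: open_neq.
have st' : s - t != 0.
  rewrite subr_eq0; near: s; exact: within_I01_neq.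
by field; rewrite gs0 gt0 st'.
Unshelve. all: by end_near. Qed.

Lemma is_deriv01_div g h t lg lh : I01 t -> h t != 0 ->
  is_deriv01 g t lg -> is_deriv01 h t lh ->
  is_deriv01 (fun s => g s / h s) t ((lg * h t - g t * lh) / h t ^+ 2).
Proof.
move=> It ht0 gl hl.
have -> : (lg * h t - g t * lh) / h t ^+ 2 = lg * (h t)^-1 + g t * (- lh / h t ^+ 2).
  by field.
exact: is_deriv01M gl (is_deriv01V It ht0 hl).
Qed.

(** Away from the endpoints the restriction to [0,1] is invisible, which gives
    access to the two-sided derivative. *)
Lemma is_deriv01_is_derive g t l : 0 < t < 1 -> is_deriv01 g t l ->
  is_derive t 1 g l.
Proof.
move=> /andP[t0 t1] gl.
suff cv : z^-1 *: ((g \o shift t) (z *: (1 : R)) - g t) @[z --> 0^'] --> l.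
  apply: DeriveDef; first by apply/cvg_ex; exists l.
  exact: cvg_lim.
apply/cvgrPdist_lt => /= e e0.
have /cvgrPdist_lt/(_ _ e0)/nbhs_ballP[d /= d0 hd] := gl.
pose r := Num.min d (Num.min t (1 - t)).
have r0 : 0 < r by rewrite !lt_min d0 t0 subr_gt0.
exists r => //= z; rewrite /ball_/= sub0r normrN => zr z0.
have zt : `|z| < t by rewrite (lt_le_trans zr)// !ge_min lexx orbT.
have zt1 : `|z| < 1 - t by rewrite (lt_le_trans zr)// !ge_min lexx !orbT.
have zd : `|z| < d by rewrite (lt_le_trans zr)// ge_min lexx.
have := hd (z + t); rewrite /ball/= addrK opprD addrCA subrr addr0 normrN.
rewrite [z%:A]mulr1 /GRing.scale/= mulrC; apply => //.
  by rewrite -subr_eq0 addrK.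
by apply/I01P; move: zt zt1; rewrite !ltr_norml => /andP[? ?] /andP[? ?]; apply/andP; split; lra.
Qed.
Lemma nbhs_within_I01 (A : set R) t : nbhs t A -> \forall s \near within I01 t^', A s.
Proof. by rewrite /within/=; apply: filterS. Qed.

Lemma eq_is_deriv01_pos g h t l : 0 < t -> I01 t ->
  (forall s, I01 s -> 0 < s -> g s = h s) -> is_deriv01 g t l -> is_deriv01 h t l.
Proof.
move=> t0 It gh; apply: cvg_trans; apply: near_eq_cvg.
near=> s; rewrite !gh//; near: s; first exact: withinT.
by apply: nbhs_within_I01; exact: lt_nbhsr.
Unshelve. all: by end_near. Qed.

Lemma twice_differentiable01_div g h : (forall t, I01 t -> h t != 0) ->
  twice_differentiable01 g -> twice_differentiable01 h ->
  twice_differentiable01 (fun t => g t / h t).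
Proof.
move=> h0 [dg ddg] [dh ddh].
have D t : I01 t -> is_deriv01 (fun t => g t / h t) t
    ((deriv01 g t * h t - g t * deriv01 h t) / h t ^+ 2).
  by move=> It; apply: is_deriv01_div => //; [exact: h0|exact: dg|exact: dh].
split=> t It; first exact: is_deriv01_derivable (D t It).
have DN := is_deriv01B (is_deriv01M (ddg t It) (dh t It)) (is_deriv01M (dg t It) (ddh t It)).
have DD := is_deriv01_div It (mulf_neq0 (h0 t It) (h0 t It)) DN
  (is_deriv01M (dh t It) (dh t It)).
apply: (@is_deriv01_derivable _ _ _ (eq_is_deriv01 It _ DD)) => s Is.
by rewrite (is_deriv01E Is (D s Is)) expr2.
Qed.

Lemma deriv01_ge0 g t : I01 t -> derivable01 g t ->
  (forall s s', I01 s -> I01 s' -> s <= s' -> g s <= g s') -> 0 <= deriv01 g t.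
Proof.
move=> It dg nd; have FF := within_I01_proper It.
apply: limr_ge => //; near=> s.
have Is : I01 s by near: s; exact: withinT.
have [st|/ltW ts] := leP s t.
  by rewrite -mulrNN -invrN !opprB mulr_ge0 ?invr_ge0 ?subr_ge0// nd.
by rewrite mulr_ge0 ?invr_ge0 ?subr_ge0// nd.
Unshelve. all: by end_near. Qed.

Lemma twice_differentiable01_continuous g : twice_differentiable01 g ->
  {within `[0, 1], continuous g} /\ {within `[0, 1], continuous (deriv01 g)}.
Proof.
move=> [dg ddg]; split; first exact: (@is_deriv01_within_continuous g (deriv01 g)).
exact: (@is_deriv01_within_continuous _ (deriv01 (deriv01 g))).
Qed.

End deriv01_theory.


(** * Integration against signed measures *)

Section charge_integral_theory.
Context {R : realType}.
Notation mu := (@lebesgue_measure R).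
Notation MR := (measurableTypeR R).
Implicit Types (xi nu : {charge set MR -> \bar R}) (g h : R -> R).

Notation pos xi := (jordan_pos (hahn_spec xi)).
Notation neg xi := (jordan_neg (hahn_spec xi)).

(** Integrability against both parts of the Hahn-Jordan decomposition that
    defines [charge_integral]. *)
Definition charge_integrable xi g : Prop :=
  (pos xi).-integrable I01 (EFin \o g) /\ (neg xi).-integrable I01 (EFin \o g).

Definition bounded_measurable01 g : Prop :=
  measurable_fun I01 g /\ exists M : R, forall t, I01 t -> `|g t| <= M.

Lemma bounded_measurable01_boundedP g : bounded_measurable01 g -> [bounded g t | t in I01].
Proof.
move=> [_ [M gM]]; exists M; split; first exact: num_real.
by move=> x Mx t It; rewrite /= (le_trans (gM t It))// ltW.
Qed.

Lemma bounded_measurable01_integrable (m : {finite_measure set MR -> \bar R}) g :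
  bounded_measurable01 g -> m.-integrable I01 (EFin \o g).
Proof.
move=> bg; have mg := bg.1; apply: measurable_bounded_integrable => //.
- exact: measurable_I01.
- by rewrite ltey_eq fin_num_measure//; exact: measurable_I01.
- exact: bounded_measurable01_boundedP.
Qed.

Lemma bounded_measurable01_charge_integrable xi g :
  bounded_measurable01 g -> charge_integrable xi g.
Proof. by move=> bg; split; exact: bounded_measurable01_integrable. Qed.

Lemma bounded_measurable01M g h : bounded_measurable01 g -> bounded_measurable01 h ->
  bounded_measurable01 (fun t => g t * h t).
Proof.
move=> [mg [M gM]] [mh [N hN]]; split; first exact: measurable_funM.
exists (M * N) => t It; rewrite normrM ler_pM//; [exact: gM|exact: hN].
Qed.

Lemma continuous_bounded_measurable01 g : {within `[0, 1], continuous g} ->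
  bounded_measurable01 g.
Proof.
move=> cg; split.
  by apply: subspace_continuous_measurable_fun => //; exact: measurable_I01.
have [M [_ gM]] := compact_bounded (continuous_compact cg (@segment_compact R 0 1)).
exists (M + 1) => t It; apply: gM; first by rewrite ltrDl.
by exists t.
Qed.

Lemma charge_jordanE xi A : measurable A -> (xi A = pos xi A - neg xi A)%E.
Proof.
by move=> mA; have := jordan_decomp (hahn_spec xi) mA; rewrite /cadd/= /cscale mulN1e.
Qed.

(** The integral does not depend on the decomposition: if [xi] is a difference
    [m1 - m2] of measures, then [pos xi + m2] and [neg xi + m1] are the same
    measure. All the algebraic rules below reduce to this. *)
Lemma charge_integralE xi (m1 m2 : {measure set MR -> \bar R}) g :
  (forall A, measurable A -> xi A + m2 A = m1 A)%E ->
  charge_integrable xi g ->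
  m1.-integrable I01 (EFin \o g) -> m2.-integrable I01 (EFin \o g) ->
  charge_integral xi g = \int[m1]_(t in I01) g t - \int[m2]_(t in I01) g t.
Proof.
move=> xim [ip in_] i1 i2.
have mI := @measurable_I01 R.
have E : (\int[pos xi]_(t in I01) (g t)%:E + \int[m2]_(t in I01) (g t)%:E =
          \int[neg xi]_(t in I01) (g t)%:E + \int[m1]_(t in I01) (g t)%:E)%E.
  rewrite -!integral_measure_add//; apply: eq_measure_integral => A mA _.
  rewrite -[LHS]/(measure_add (pos xi) m2 A) -[RHS]/(measure_add (neg xi) m1 A).
  rewrite !measure_addE -xim// addeA; congr (_ + _)%E.
  rewrite (charge_jordanE xi mA).
  by rewrite addeCA subee ?adde0// fin_num_measure.
have fp := integrable_fin_num mI ip; have fn := integrable_fin_num mI in_.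
have f1 := integrable_fin_num mI i1; have f2 := integrable_fin_num mI i2.
have := congr1 fine E; rewrite (fineD fp f2) (fineD fn f1).
rewrite /charge_integral /Rintegral => {}E.
by apply/eqP; rewrite subr_eq addrAC eq_sym subr_eq; apply/eqP; rewrite addrC -E; ring.
Qed.

Lemma charge_integralD xi g h : charge_integrable xi g -> charge_integrable xi h ->
  charge_integral xi (fun t => g t + h t) = charge_integral xi g + charge_integral xi h.
Proof.
move=> [gp gn] [hp hn]; have mI := @measurable_I01 R.
by rewrite /charge_integral !RintegralD//; ring.
Qed.

Lemma charge_integralZl xi (a : R) g : charge_integrable xi g ->
  charge_integral xi (fun t => a * g t) = a * charge_integral xi g.
Proof.
move=> [gp gn]; have mI := @measurable_I01 R.
by rewrite /charge_integral !RintegralZl//; ring.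
Qed.

Lemma eq_charge_integral xi g h : (forall t, I01 t -> g t = h t) ->
  charge_integral xi g = charge_integral xi h.
Proof.
by move=> gh; rewrite /charge_integral; congr (_ - _); apply: eq_Rintegral => t /set_mem; exact: gh.
Qed.

Lemma integrable_mscale (m : {measure set MR -> \bar R}) (k : {nonneg R}) g :
  m.-integrable I01 (EFin \o g) ->
  (mscale k m).-integrable I01 (EFin \o g) /\
  \int[mscale k m]_(t in I01) g t = k%:num * \int[m]_(t in I01) g t.
Proof.
move=> ig; have mI := @measurable_I01 R.
have mg := measurable_int _ ig.
split.
  apply/integrableP; split => //.
  rewrite ge0_integral_mscale//; last exact: measurableT_comp.
  by rewrite lte_mul_pinfty//; case/integrableP : ig.
rewrite -[k%:num]/(fine k%:num%:E) /Rintegral -fineM//; last exact: integrable_fin_num.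
congr fine; rewrite [LHS]integralE [X in _ = (_ * X)%E]integralE.
rewrite !ge0_integral_mscale//; [|exact: measurable_funeneg|exact: measurable_funepos].
rewrite [RHS]muleBr// fin_num_adde_defr// integrable_fin_num//.
exact: integrable_funepos.
Qed.

Lemma charge_integral_cscale xi (a : R) g :
  charge_integrable xi g -> charge_integrable (cscale a xi) g ->
  charge_integral (cscale a xi) g = a * charge_integral xi g.
Proof.
move=> [gp gn] ga.
have [a0|/ltW a0] := leP 0 a.
- pose k := NngNum a0.
  have [i1 e1] := integrable_mscale k gp; have [i2 e2] := integrable_mscale k gn.
  rewrite (charge_integralE _ ga i1 i2) ?e1 ?e2 -?mulrBr// => A mA.
  rewrite /= /mscale/= /cscale (charge_jordanE xi mA).
  have := @fin_num_measure _ _ _ (pos xi) A mA; have := @fin_num_measure _ _ _ (neg xi) A mA.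
  move=> /fineK <- /fineK <-.
  by rewrite -EFinB -!EFinM -EFinD; congr EFin; ring.
- have na0 : 0 <= - a by rewrite oppr_ge0.
  pose k := NngNum na0.
  have [i1 e1] := integrable_mscale k gp; have [i2 e2] := integrable_mscale k gn.
  rewrite (charge_integralE _ ga i2 i1).
    by rewrite e1 e2 /charge_integral /=; ring.
  move=> A mA; rewrite /= /mscale/= /cscale (charge_jordanE xi mA).
  have := @fin_num_measure _ _ _ (pos xi) A mA; have := @fin_num_measure _ _ _ (neg xi) A mA.
  move=> /fineK <- /fineK <-.
  by rewrite -EFinB -!EFinM -EFinD; congr EFin; ring.
Qed.

Lemma charge_integral_cadd xi nu g :
  charge_integrable xi g -> charge_integrable nu g -> charge_integrable (cadd xi nu) g ->
  charge_integral (cadd xi nu) g = charge_integral xi g + charge_integral nu g.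
Proof.
move=> [xp xn] [np nn] xng; have mI := @measurable_I01 R.
have i_add (m1 m2 : {measure set MR -> \bar R}) : m1.-integrable I01 (EFin \o g) ->
    m2.-integrable I01 (EFin \o g) -> (measure_add m1 m2).-integrable I01 (EFin \o g) /\
    \int[measure_add m1 m2]_(t in I01) g t = \int[m1]_(t in I01) g t + \int[m2]_(t in I01) g t.
  move=> i1 i2; split; last first.
    rewrite /Rintegral integral_measure_add//.
    exact: (fineD (integrable_fin_num mI i1) (integrable_fin_num mI i2)).
  apply/integrableP; split; first exact: measurable_int i1.
  rewrite ge0_integral_measure_add//.
    by apply: lte_add_pinfty; [case/integrableP : i1|case/integrableP : i2].
  by apply: measurableT_comp => //; exact: measurable_int i1.
have [ip ep] := i_add _ _ xp np; have [in_ en] := i_add _ _ xn nn.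
rewrite (charge_integralE _ xng ip in_).
  by rewrite ep en /charge_integral; ring.
move=> A mA.
rewrite -[X in (_ + X)%E]/(measure_add (neg xi) (neg nu) A).
rewrite -[RHS]/(measure_add (pos xi) (pos nu) A).
rewrite !measure_addE -[X in (X + _)%E]/(xi A + nu A)%E (charge_jordanE xi mA) (charge_jordanE nu mA).
rewrite -[X in (_ + X)%E]/(neg xi A + neg nu A)%E -[RHS]/(pos xi A + pos nu A)%E.
have := @fin_num_measure _ _ _ (pos xi) A mA; have := @fin_num_measure _ _ _ (neg xi) A mA.
have := @fin_num_measure _ _ _ (pos nu) A mA; have := @fin_num_measure _ _ _ (neg nu) A mA.
move=> /fineK <- /fineK <- /fineK <- /fineK <-.
by rewrite -!EFinB -!EFinD; congr EFin; ring.
Qed.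

Lemma charge_integral_dirac (a : R) g : I01 a -> bounded_measurable01 g ->
  charge_integral (dirac_charge a) g = g a.
Proof.
move=> Ia bg; have mI := @measurable_I01 R; have mg := bg.1.
rewrite (@charge_integralE _ (\d_(a : MR)) mzero).
- rewrite /Rintegral integral_dirac//; last exact/measurable_EFinP.
  by rewrite integral_measure_zero diracE mem_set// mul1e subr0.
- by move=> A mA; rewrite /= /mzero adde0.
- exact: bounded_measurable01_charge_integrable.
- exact: bounded_measurable01_integrable.
- exact: (@bounded_measurable01_integrable mzero).
Qed.

(** The two Jordan parts have Radon-Nikodym densities, and the difference of
    these is almost everywhere the given density because both have the same
    integral over every measurable set. *)
Lemma charge_integral_density (p : R -> R) (ip : mu.-integrable I01 (EFin \o p)) g :
  bounded_measurable01 g ->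
  charge_integral (density_charge ip) g = \int[mu]_(t in I01) (g t * p t).
Proof.
move=> bg; have mI := @measurable_I01 R; have mg := bg.1.
pose nu := density_charge ip.
have numu : nu `<< mu.
  apply/null_content_dominatesP => A mA muA.
  rewrite /nu /density_charge /induced_charge; apply: null_set_integral => //.
  exact: measurable_funTS (measurable_int _ (density_integrable ip)).
have np := jordan_pos_dominates (hahn_spec nu) numu.
have nn := jordan_neg_dominates (hahn_spec nu) numu.
pose rp := Radon_Nikodym (charge_of_finite_measure (pos nu)) mu.
pose rn := Radon_Nikodym (charge_of_finite_measure (neg nu)) mu.
have irp : mu.-integrable setT rp by exact: Radon_Nikodym_integrable.
have irn : mu.-integrable setT rn by exact: Radon_Nikodym_integrable.
have ae : ae_eq mu I01 (rp \- rn)%E (EFin \o p).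
  apply: integral_ae_eq => //.
  - by apply: integrableB => //; apply: (integrableS measurableT).
  - exact: measurable_int ip.
  - move=> E EI mE; rewrite integralB//; [|exact: (integrableS measurableT)..].
    rewrite -!Radon_Nikodym_integral//.
    transitivity (nu E); first by rewrite (charge_jordanE nu mE).
    rewrite /nu /density_charge /induced_charge; apply: eq_integral => t /set_mem/EI It.
    by rewrite /= patchE mem_set.
have ipp := bounded_measurable01_integrable (pos nu) bg.
have inn := bounded_measurable01_integrable (neg nu) bg.
have cp := Radon_Nikodym_change_of_variables np mI ipp.
have cn := Radon_Nikodym_change_of_variables nn mI inn.
have bdg := bounded_measurable01_boundedP bg.
have grp : mu.-integrable I01 ((EFin \o g) \* rp)%E.
  by apply: integrableMr => //; exact: (integrableS measurableT).
have grn : mu.-integrable I01 ((EFin \o g) \* rn)%E.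
  by apply: integrableMr => //; exact: (integrableS measurableT).
have ep : (\int[pos nu]_(t in I01) (g t)%:E = \int[mu]_(t in I01) ((EFin \o g) \* rp) t)%E.
  exact: esym cp.
have en : (\int[neg nu]_(t in I01) (g t)%:E = \int[mu]_(t in I01) ((EFin \o g) \* rn) t)%E.
  exact: esym cn.
have fp := integrable_fin_num mI grp; have fn := integrable_fin_num mI grn.
rewrite /charge_integral /Rintegral -/nu ep en -(fineB fp fn) -(integralB mI grp grn).
congr fine; apply: ae_eq_integral => //.
- exact: measurable_int (integrableB mI grp grn).
- apply/measurable_EFinP/measurable_funM => //.
  by apply/measurable_EFinP; exact: measurable_int ip.
- move: ae; apply: filterS => t + It => /(_ It) /=.
  rewrite EFinM => <-; rewrite muleBr// fin_num_adde_defr//.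
  by rewrite Radon_Nikodym_fin_num.
Qed.
End charge_integral_theory.

Lemma eq_bounded_measurable01 {R : realType} (g h : R -> R) :
  (forall t, I01 t -> g t = h t) -> bounded_measurable01 g -> bounded_measurable01 h.
Proof.
move=> gh [mg [M gM]]; split; last by exists M => t It; rewrite -gh// gM.
by apply: eq_measurable_fun mg => t /set_mem It; rewrite gh.
Qed.

Lemma bounded_measurable01_cst {R : realType} (a : R) : bounded_measurable01 (cst a).
Proof. by split => //; exists `|a|. Qed.


(** * Second moments of integrals of the observed process *)

Lemma normrM_le_sqrD {R : realType} (x y : R) : `|x * y| <= x ^+ 2 + y ^+ 2.
Proof.
have := sqr_ge0 (x - y); have := sqr_ge0 (x + y).
have := sqr_ge0 x; have := sqr_ge0 y.
by move=> *; rewrite ler_norml; apply/andP; split; nra.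
Qed.

Section square_integrable.
Context {d : measure_display} {T : measurableType d} {R : realType}.
Variables (m : {measure set T -> \bar R}) (D : set T).
Implicit Types Z W : T -> R.

Definition square_integrable Z : Prop :=
  measurable_fun D Z /\ m.-integrable D (EFin \o (fun w => Z w ^+ 2)).

Hypothesis mD : measurable D.

Lemma square_integrableM Z W : square_integrable Z -> square_integrable W ->
  m.-integrable D (EFin \o (fun w => Z w * W w)).
Proof.
move=> [mZ iZ] [mW iW].
have iS := integrableD mD iZ iW.
apply: (le_integrable mD _ _ iS).
  by apply/measurable_EFinP; exact: measurable_funM.
move=> w _; rewrite /comp -EFinD !abse_EFin lee_fin [leRHS]ger0_norm ?addr_ge0 ?sqr_ge0//.
exact: normrM_le_sqrD.
Qed.

Lemma square_integrable_cst (c : R) : (m D < +oo)%E -> square_integrable (cst c).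
Proof.
move=> Dfin; split; first exact: measurable_cst.
apply/integrableP; split; first exact: (measurable_cst (c ^+ 2)%:E).
rewrite -[X in (X < _)%E]/(\int[m]_(x in D) cst `|(c ^+ 2)%:E| x)%E.
by rewrite integral_cst// lte_mul_pinfty.
Qed.

Lemma square_integrableZ (a : R) Z : square_integrable Z -> square_integrable (fun w => a * Z w).
Proof.
move=> [mZ iZ]; split; first exact: measurable_funM.
apply: eq_integrable (integrableZl mD (a ^+ 2) iZ) => // w _.
by rewrite /comp -EFinM exprMn.
Qed.

Lemma square_integrableD Z W : square_integrable Z -> square_integrable W ->
  square_integrable (fun w => Z w + W w).
Proof.
move=> iZ iW; split; first exact: measurable_funD iZ.1 iW.1.
have iZW := square_integrableM iZ iW.
have i1 := integrableD mD (integrableD mD iZ.2 iW.2) (integrableZl mD 2 iZW).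
apply: eq_integrable i1 => // w _.
by rewrite /comp -EFinM -!EFinD; congr EFin; ring.
Qed.

Lemma square_integrable_integrable Z : (m D < +oo)%E ->
  square_integrable Z -> m.-integrable D (EFin \o Z).
Proof.
move=> Dfin iZ; have := square_integrableM iZ (square_integrable_cst 1 Dfin).
by rewrite (_ : (fun w => Z w * cst 1 w) = Z)//; apply/funext => w /=; rewrite mulr1.
Qed.

End square_integrable.

(** Cauchy-Schwarz against the constant 1. The extended-real right-hand side
    makes it valid for every measurable [g], hence for every path of a process. *)
Lemma sqr_Rintegral_le {R : realType} (m : {finite_measure set (measurableTypeR R) -> \bar R})
    (g : R -> R) : measurable_fun I01 g ->
  (((\int[m]_(t in I01) g t) ^+ 2)%:E <= m I01 * \int[m]_(t in I01) (g t ^+ 2)%:E)%E.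
Proof.
move=> mg; have mI := @measurable_I01 R.
have mfin : m I01 \is a fin_num by rewrite fin_num_measure.
have mg2 : measurable_fun I01 (EFin \o (fun t => g t ^+ 2)).
  by apply/measurable_EFinP; exact: measurable_funX.
have s0 : (0 <= \int[m]_(t in I01) (g t ^+ 2)%:E)%E.
  by apply: integral_ge0 => t _; rewrite lee_fin sqr_ge0.
have [m0|m0] := eqVneq (m I01) 0%E.
  rewrite m0 mul0e /Rintegral null_set_integral//; last exact/measurable_EFinP.
  by rewrite expr0n.
have mgt0 : (0 < m I01)%E by rewrite lt0e m0 measure_ge0.
have [soo|sfin] := eqVneq (\int[m]_(t in I01) (g t ^+ 2)%:E)%E +oo%E.
  by rewrite soo gt0_muley// leey.
have ig2 : m.-integrable I01 (EFin \o (fun t => g t ^+ 2)).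
  apply/integrableP; split => //.
  under eq_integral do rewrite /= ger0_norm ?sqr_ge0//.
  by rewrite ltey.
have i1 : m.-integrable I01 (EFin \o cst 1) by exact: finite_measure_integrable_cst.
have ig : m.-integrable I01 (EFin \o g).
  apply: (le_integrable mI _ _ (integrableD mI ig2 i1)); first exact/measurable_EFinP.
  move=> t _; rewrite /comp /cst -EFinD !abse_EFin lee_fin [leRHS]ger0_norm ?addr_ge0 ?sqr_ge0//.
  by have := normrM_le_sqrD (g t) 1; rewrite mulr1 expr1n.
set a := \int[m]_(t in I01) g t; pose Mm := fine (m I01).
have Mm0 : 0 < Mm by rewrite fine_gt0// mgt0 ltey_eq mfin.
(* the integrand is (Mm * g t - a) ^+ 2 *)
have : 0 <= \int[m]_(t in I01) ((Mm ^+ 2) * g t ^+ 2 + ((- 2 * Mm * a) * g t + a ^+ 2 * 1)).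
  apply: Rintegral_ge0 => t _.
  rewrite (_ : _ + _ = (Mm * g t - a) ^+ 2); first exact: sqr_ge0.
  by ring.
have Z1 := integrableZl mI (Mm ^+ 2) ig2.
have Z2 := integrableZl mI (- 2 * Mm * a) ig.
have Z3 := integrableZl mI (a ^+ 2) i1.
rewrite (RintegralD mI Z1 (integrableD mI Z2 Z3)) (RintegralD mI Z2 Z3).
rewrite !RintegralZl// -/a.
rewrite (Rintegral_cst m mI 1) mul1r -/Mm.
rewrite -(fineK mfin) -(fineK (integrable_fin_num mI ig2)) -EFinM lee_fin -/Mm.
set s := Rintegral _ _ _ => h.
rewrite -[fine _]/s -(ler_pM2l Mm0).
nra.
Qed.

Section path_integral.
Context {R : realType} {d : measure_display} {T : measurableType d}.
Notation MR := (measurableTypeR R).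
Implicit Types Y : R -> T -> R.

(** Fubini's theorem is applied on the whole product space, so the process is
    continued by 0 outside of [0,1]. *)
Definition extend01 Y : MR * T -> R := (fun x => Y x.1 x.2) \_ (I01 `*` setT).

Lemma extend01_in Y t w : I01 t -> extend01 Y (t, w) = Y t w.
Proof. by move=> It; rewrite /extend01 patchE mem_set. Qed.

Lemma extend01_out Y t w : ~ I01 t -> extend01 Y (t, w) = 0.
Proof. by move=> It; rewrite /extend01 patchE memNset// => -[]. Qed.

Lemma extend01_section Y w :
  (fun t => (extend01 Y (t, w))%:E) = (EFin \o Y ^~ w) \_ I01.
Proof.
apply/funext => t; rewrite patchE; case: ifPn => [/set_mem It|/negP It].
  by rewrite extend01_in.
by rewrite extend01_out// => It'; apply: It; exact/mem_set.
Qed.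

Lemma measurable_extend01 Y : jointly_measurable01 Y -> measurable_fun setT (extend01 Y).
Proof.
move=> mY; apply: (measurable_restrictT _ _).1 => //.
by apply: measurableX => //; exact: measurable_I01.
Qed.

Lemma measurable_path Y w : jointly_measurable01 Y -> measurable_fun I01 (Y ^~ w).
Proof.
move=> mY; apply/measurable_EFinP; apply/(measurable_restrictT _ (@measurable_I01 R)).
rewrite -extend01_section; apply/measurable_EFinP.
exact: measurableT_comp (measurable_extend01 mY) (measurable_pair2 _).
Qed.

(** Positive and negative parts are integrated separately, so that the paths
    which fail to be integrable are covered as well. *)
Lemma measurable_path_integral (m : {finite_measure set MR -> \bar R}) Y :
  jointly_measurable01 Y -> measurable_fun setT (fun w => \int[m]_(t in I01) Y t w).
Proof.
move=> mY; have mE : measurable_fun setT (EFin \o extend01 Y).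
  by apply/measurable_EFinP; exact: measurable_extend01.
rewrite (_ : (fun w => _) = fun w => fine (\int[m]_t ((EFin \o extend01 Y)^\+%E (t, w))
    - \int[m]_t ((EFin \o extend01 Y)^\-%E (t, w)))%E).
  apply: measurableT_comp => //; apply: emeasurable_funB.
  - apply: (@measurable_fun_fubini_tonelli_G _ _ _ _ _ m (EFin \o extend01 Y)^\+%E) => //.
    exact: measurable_funepos.
  - apply: (@measurable_fun_fubini_tonelli_G _ _ _ _ _ m (EFin \o extend01 Y)^\-%E) => //.
    exact: measurable_funeneg.
apply/funext => w; rewrite /Rintegral integral_mkcond; congr fine.
transitivity (\int[m]_t (extend01 Y (t, w))%:E)%E; last first.
  by rewrite integralE; congr (_ - _)%E; apply: eq_integral => t _; rewrite ?funeposE ?funenegE.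
apply: eq_integral => t _; apply: esym; move: t; apply/funeqP.
exact: extend01_section.
Qed.

Lemma measurable_charge_integral xi Y : jointly_measurable01 Y ->
  measurable_fun setT (fun w => charge_integral xi (Y ^~ w)).
Proof.
move=> mY; apply: measurable_funB.
- exact: (measurable_path_integral (jordan_pos (hahn_spec xi)) mY).
- exact: (measurable_path_integral (jordan_neg (hahn_spec xi)) mY).
Qed.

Lemma jointly_measurable_time (g : R -> R) : measurable_fun I01 g ->
  jointly_measurable01 (fun t (_ : T) => g t).
Proof.
move=> mg; apply: (@measurable_comp _ _ _ _ _ _ I01 g) => //.
- exact: measurable_I01.
- by move=> _ [[t w] [It _] <-].
- exact: measurable_funTS measurable_fst.
Qed.

Lemma jointly_measurable_observation (f : R -> R) (eps : R -> T -> R) :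
  measurable_fun I01 f -> jointly_measurable01 eps ->
  jointly_measurable01 (observation f eps).
Proof.
by move=> mf meps; apply: measurable_funD => //; exact: jointly_measurable_time.
Qed.

End path_integral.

Section random_integral.
Context {R : realType} {d : measure_display} {T : measurableType d}.
Variable P : probability T R.
Notation MR := (measurableTypeR R).
Variables (eps : R -> T -> R) (K : R -> R -> R) (M : R).
Hypothesis eps_meas : jointly_measurable01 eps.
Hypothesis eps_sq : forall t, I01 t -> square_integrable P setT (eps t).
Hypothesis eps_cov : forall s t, I01 s -> I01 t ->
  \int[P]_w (eps s w * eps t w) = K s t.
Hypothesis KM : forall t, I01 t -> K t t <= M.

Let PT : (P setT < +oo)%E. Proof. by rewrite probability_setT ltry. Qed.

Let cst1 := square_integrable_cst measurableT 1 PT.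

Let mI := @measurable_I01 R.

Let e01 : MR * T -> R := extend01 eps.

Let me01 : measurable_fun setT e01 := measurable_extend01 eps_meas.

Let e01E t w : I01 t -> e01 (t, w) = eps t w. Proof. exact: extend01_in. Qed.

Let e010 t w : ~ I01 t -> e01 (t, w) = 0. Proof. exact: extend01_out. Qed.

Let e01_section w : (fun t => (e01 (t, w))%:E) = (EFin \o eps ^~ w) \_ I01.
Proof. exact: extend01_section. Qed.

Section finite_measure.
Variable m : {finite_measure set MR -> \bar R}.

Definition random_integral (w : T) : R := \int[m]_(t in I01) eps t w.

Let sq_integrable : (m \x P)%E.-integrable setT (EFin \o (fun x => e01 x ^+ 2)).
Proof.
apply/integrable12ltyP; first by apply/measurable_EFinP; exact: measurable_funX.
apply: (@le_lt_trans _ _ (\int[m]_(t in setT) (cst `|M|%:E t))%E); last first.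
  rewrite integral_cst// -ge0_fin_numE ?mule_ge0//.
  by rewrite fin_numM// fin_num_measure.
apply: ge0_le_integral => //.
- by move=> t _; apply: integral_ge0.
- apply: (@measurable_fun_fubini_tonelli_F _ _ _ _ _ P (fun x => `|(e01 x ^+ 2)%:E|%E)) => //.
  by apply/measurableT_comp => //; apply/measurable_EFinP; exact: measurable_funX.
- move=> t _; have [It|It] := pselect (I01 t).
    under eq_integral => w _ do rewrite /= e01E// ger0_norm ?sqr_ge0//.
    have [_ it] := eps_sq It.
    rewrite -(fineK (integrable_fin_num measurableT it)) lee_fin.
    apply: le_trans (ler_norm M); apply: le_trans (KM It).
    rewrite -eps_cov// /Rintegral le_eqVlt; apply/orP; left; apply/eqP; congr fine.
  under eq_integral => w _ do rewrite /= e010// expr0n normr0.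
  by rewrite integral0_eq// lee_fin.
Qed.

(** The bound [`|x * y| <= x ^+ 2 + y ^+ 2] reduces product integrability to the
    bounded variance of the process and the finiteness of the two measures. *)
Lemma random_integrableM Z : square_integrable P setT Z ->
  (m \x P)%E.-integrable setT (EFin \o (fun x => e01 x * Z x.2)).
Proof.
move=> [mZ iZ].
have iZ2 : (m \x P)%E.-integrable setT (EFin \o (fun x => Z x.2 ^+ 2)).
  apply/integrable12ltyP.
    by apply/measurable_EFinP/measurable_funX; exact: measurableT_comp.
  under eq_integral => t _.
    under eq_integral do rewrite /= ger0_norm ?sqr_ge0//.
    over.
  rewrite integral_cst// -ge0_fin_numE ?mule_ge0 ?integral_ge0//; last first.
    by move=> w _; rewrite lee_fin sqr_ge0.
  by rewrite fin_numM// ?fin_num_measure//; exact: integrable_fin_num.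
have iS := integrableD measurableT sq_integrable iZ2.
apply: (le_integrable measurableT _ _ iS).
  by apply/measurable_EFinP/measurable_funM => //; exact: measurableT_comp.
move=> x _; rewrite /comp -EFinD !abse_EFin lee_fin [leRHS]ger0_norm ?addr_ge0 ?sqr_ge0//.
exact: normrM_le_sqrD.
Qed.
Lemma ae_random_integrable :
  {ae P, forall w, m.-integrable I01 (EFin \o eps ^~ w)}.
Proof.
have := ae_integrable2 (random_integrableM cst1).
apply: filterS => w /=.
under eq_fun do rewrite mulr1.
by rewrite e01_section => /(integrable_mkcond _ mI).2.
Qed.

Lemma measurable_random_integral : measurable_fun setT random_integral.
Proof. exact: measurable_path_integral. Qed.

Lemma square_integrable_random_integral : square_integrable P setT random_integral.
Proof.
split; first exact: measurable_random_integral.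
have mX2 : measurable_fun setT (EFin \o (fun w => random_integral w ^+ 2)).
  by apply/measurable_EFinP/measurable_funX; exact: measurable_random_integral.
apply/integrableP; split => //.
pose B w := (m I01 * \int[m]_t (e01 (t, w) ^+ 2)%:E)%E.
have i2 : P.-integrable setT (fun w => \int[m]_t (e01 (t, w) ^+ 2)%:E)%E.
  apply/integrableP; split; first exact: measurable_fubini_G sq_integrable.
  have /integrable21ltyP h := sq_integrable.
  have {h} := h _; under [in X in X -> _]eq_integral => w _.
    under eq_integral do rewrite /= ger0_norm ?sqr_ge0//.
    over.
  under [in X in _ -> X]eq_integral => w _.
    rewrite gee0_abs; last by apply: integral_ge0 => t _; rewrite lee_fin sqr_ge0.
    over.
  by apply; apply/measurable_EFinP; exact: measurable_funX.
have mfin : m I01 \is a fin_num by rewrite fin_num_measure.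
have iB : P.-integrable setT B.
  by rewrite /B -(fineK mfin); exact: integrableZl.
case/integrableP : iB => mB; apply: le_lt_trans.
apply: ge0_le_integral => //.
- exact: measurableT_comp.
- exact: measurableT_comp.
- move=> w _; apply: (@le_trans _ _ (B w)); last exact: lee_abs.
  rewrite /= ger0_norm ?sqr_ge0//.
  apply: (le_trans (sqr_Rintegral_le m (measurable_path w eps_meas))).
  rewrite /B integral_mkcond le_eqVlt; apply/orP; left; apply/eqP; congr (_ * _)%E.
  apply: eq_integral => t _; rewrite patchE; case: ifPn => [/set_mem It|/negP It].
    by rewrite e01E.
  by rewrite e010 ?expr0n// => It'; apply: It; exact/mem_set.
Qed.

(** Fubini's theorem: integrating the process commutes with taking its product
    moment with a square integrable variable. *)
Lemma expectation_random_integralM Z : square_integrable P setT Z ->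
  \int[P]_w (random_integral w * Z w) = \int[m]_(t in I01) \int[P]_w (eps t w * Z w) /\
  m.-integrable I01 (EFin \o (fun t => \int[P]_w (eps t w * Z w))).
Proof.
move=> iZ; have ieZ := random_integrableM iZ.
have FE t : I01 t ->
    (\int[P]_w (e01 (t, w) * Z w)%:E = (\int[P]_w (eps t w * Z w))%:E)%E.
  move=> It; rewrite /Rintegral fineK.
    by apply: eq_integral => w _; rewrite e01E.
  exact: integrable_fin_num (square_integrableM measurableT (eps_sq It) iZ).
have F0 t : ~ I01 t -> (\int[P]_w (e01 (t, w) * Z w)%:E = 0)%E.
  by move=> It; apply: integral0_eq => w _; rewrite e010// mul0r.
have FI : (fun t => \int[P]_w (e01 (t, w) * Z w)%:E)%E =
    (EFin \o (fun t => \int[P]_w (eps t w * Z w))) \_ I01.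
  apply/funext => t; rewrite patchE; case: ifPn => [/set_mem It|/negP It].
    exact: FE.
  by apply: F0 => It'; apply: It; exact/mem_set.
split; last first.
  apply/(integrable_mkcond _ mI); rewrite -FI.
  exact: (integrable_fubini_F ieZ).
rewrite /Rintegral; congr fine.
transitivity (\int[P]_w \int[m]_t (e01 (t, w) * Z w)%:E)%E.
  apply: ae_eq_integral => //.
  - apply/measurable_EFinP/measurable_funM; [exact: measurable_random_integral|exact: iZ.1].
  - exact: measurable_fubini_G ieZ.
  - have := ae_random_integrable; apply: filterS => w iw _ /=.
    rewrite EFinM /random_integral /Rintegral fineK; last exact: integrable_fin_num.
    rewrite -(integralZr mI iw) integral_mkcond; apply: eq_integral => t _.
    rewrite patchE; case: ifPn => [/set_mem It|/negP It].
      by rewrite EFinM e01E.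
    by rewrite e010 ?mul0r// => It'; apply: It; exact/mem_set.
rewrite -(Fubini ieZ) [RHS]integral_mkcond; apply: eq_integral => t _.
by move: t; have /funeqP := FI.
Qed.
End finite_measure.

Notation pos xi := (jordan_pos (hahn_spec xi)).
Notation neg xi := (jordan_neg (hahn_spec xi)).
Implicit Types xi nu : {charge set MR -> \bar R}.

(** The random part of the linear statistic given by [xi]. *)
Definition noise xi (w : T) : R := charge_integral xi (eps ^~ w).

Lemma square_integrable_noise xi : square_integrable P setT (noise xi).
Proof.
have h := square_integrableD measurableT (square_integrable_random_integral (pos xi))
  (square_integrableZ measurableT (-1) (square_integrable_random_integral (neg xi))).
rewrite (_ : noise xi = fun w => random_integral (pos xi) w + -1 * random_integral (neg xi) w)//.
by apply/funext => w; rewrite mulN1r.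
Qed.

Lemma ae_noise_integrable xi : {ae P, forall w, charge_integrable xi (eps ^~ w)}.
Proof.
have := ae_random_integrable (neg xi); have := ae_random_integrable (pos xi).
by apply: filterS2 => w ip in_; split.
Qed.

Lemma expectation_noiseM xi Z : square_integrable P setT Z ->
  \int[P]_w (noise xi w * Z w) = charge_integral xi (fun t => \int[P]_w (eps t w * Z w)).
Proof.
move=> iZ.
have [ep _] := expectation_random_integralM (pos xi) iZ.
have [en _] := expectation_random_integralM (neg xi) iZ.
have ip := square_integrableM measurableT (square_integrable_random_integral (pos xi)) iZ.
have in_ := square_integrableM measurableT (square_integrable_random_integral (neg xi)) iZ.
rewrite /charge_integral -ep -en -RintegralB//.
by apply: eq_Rintegral => w _; rewrite -mulrBl.
Qed.

(** Apply the product-moment formula first with [Z = noise nu] and then, for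
    each [t], with [Z = eps t]. *)
Lemma covariance_noise xi nu : \int[P]_w (noise xi w * noise nu w) =
  charge_integral xi (fun t => charge_integral nu (fun s => K s t)).
Proof.
rewrite expectation_noiseM; last exact: square_integrable_noise.
apply: eq_charge_integral => t It.
under eq_Rintegral do rewrite mulrC.
rewrite expectation_noiseM; last exact: eps_sq.
by apply: eq_charge_integral => s Is; rewrite eps_cov.
Qed.

Lemma variance_noise_ge0 xi :
  0 <= charge_integral xi (fun t => charge_integral xi (fun s => K s t)).
Proof.
by rewrite -covariance_noise; apply: Rintegral_ge0 => w _; rewrite -expr2 sqr_ge0.
Qed.

Hypothesis eps_mean : forall t, I01 t -> \int[P]_w eps t w = 0.

Lemma expectation_noise xi : \int[P]_w noise xi w = 0.
Proof.
have := expectation_noiseM xi cst1.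
under eq_Rintegral do rewrite mulr1.
move=> ->; rewrite (eq_charge_integral _ (h := cst 0)).
  by rewrite /charge_integral /Rintegral !integral0 subrr.
by move=> t It; under eq_Rintegral do rewrite mulr1; exact: eps_mean.
Qed.

Variable f : R -> R.
Hypothesis bf : bounded_measurable01 f.

(** Squared bias plus variance of the linear statistic given by [xi], as an
    estimator of the number [th]. *)
Definition estimation_risk xi (th : R) : R :=
  (charge_integral xi f - th) ^+ 2 +
  charge_integral xi (fun t => charge_integral xi (fun s => K s t)).

Lemma ae_observation xi : {ae P, forall w,
  charge_integral xi (fun t => observation f eps t w) = charge_integral xi f + noise xi w}.
Proof.
apply: filterS (ae_noise_integrable xi) => w iw.
exact: charge_integralD (bounded_measurable01_charge_integrable xi bf) iw.
Qed.

Lemma expectation_estimation xi (th : R) :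
  ('E_P[(fun w => (charge_integral xi (fun t => observation f eps t w) - th) ^+ 2)%R] =
    (estimation_risk xi th)%:E)%E.
Proof.
pose A := charge_integral xi f - th.
have iN := square_integrable_noise xi.
have iA := square_integrableD measurableT (square_integrable_cst measurableT A PT) iN.
rewrite unlock.
transitivity (\int[P]_w ((A + noise xi w) ^+ 2)%:E)%E.
  apply: ae_eq_integral => //.
  - apply/measurable_EFinP/measurable_funX/measurable_funB => //.
    by apply: measurable_charge_integral; exact: jointly_measurable_observation bf.1 eps_meas.
  - by apply/measurable_EFinP/measurable_funX/measurable_funD => //; exact: iN.1.
  - have := ae_observation xi; apply: filterS => w + _ /= => ->.
    by rewrite /A addrAC.
rewrite -[LHS]fineK; last exact: integrable_fin_num iA.2.
congr EFin; rewrite -[LHS]/(\int[P]_w ((A + noise xi w) ^+ 2)).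
have i1 := finite_measure_integrable_cst P (A ^+ 2) measurableT.
have i2 := integrableZl measurableT (2 * A) (square_integrable_integrable measurableT PT iN).
have iS := integrableD measurableT i1 i2.
transitivity (\int[P]_w ((A ^+ 2 + (2 * A) * noise xi w) + noise xi w ^+ 2)).
  by apply: eq_Rintegral => w _; ring.
rewrite (RintegralD measurableT iS iN.2) (RintegralD measurableT i1 i2).
rewrite (RintegralZl _ _ (square_integrable_integrable measurableT PT iN))// expectation_noise mulr0 addr0.
rewrite (Rintegral_cst P measurableT (A ^+ 2)) [X in fine X](@probability_setT _ _ _ P) mulr1.
rewrite /estimation_risk; congr (_ + _); rewrite -covariance_noise.
by apply: eq_Rintegral => w _; rewrite expr2.
Qed.

(** If [nu] solves [\int K(s, t) nu(ds) = f(t)], then the covariance of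
    [noise xi] and [noise nu] is the integral of [f] against [xi], and the variance
    of [noise nu] is [c]. Expanding [E (noise xi - la * noise nu)^2 >= 0] with
    [la = th / (1 + c)] then bounds the variance below by an affine function of
    the bias, and completing a square leaves [th ^+ 2 / (1 + c)]. *)
Lemma estimation_risk_ge xi nu (th c : R) :
  (forall t, I01 t -> charge_integral nu (fun s => K s t) = f t) ->
  charge_integral nu f = c -> 1 + c != 0 ->
  th ^+ 2 / (1 + c) <= estimation_risk xi th.
Proof.
move=> Kf fc c0; pose la := th / (1 + c).
have iX := square_integrable_noise xi; have iN := square_integrable_noise nu.
have cN : \int[P]_w (noise nu w * noise nu w) = c.
  by rewrite covariance_noise -fc; exact: eq_charge_integral.
have cXN : \int[P]_w (noise xi w * noise nu w) = charge_integral xi f.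
  by rewrite covariance_noise; exact: eq_charge_integral.
have : 0 <= \int[P]_w (noise xi w * noise xi w + ((- 2 * la) * (noise xi w * noise nu w) +
    la ^+ 2 * (noise nu w * noise nu w))).
  apply: Rintegral_ge0 => w _.
  rewrite (_ : _ + _ = (noise xi w - la * noise nu w) ^+ 2); first exact: sqr_ge0.
  by ring.
have i1 := square_integrableM measurableT iX iX.
have i2' := square_integrableM measurableT iX iN; have i2 := integrableZl measurableT (- 2 * la) i2'.
have i3' := square_integrableM measurableT iN iN; have i3 := integrableZl measurableT (la ^+ 2) i3'.
rewrite (RintegralD measurableT i1 (integrableD measurableT i2 i3)).
rewrite (RintegralD measurableT i2 i3) !RintegralZl// cN cXN covariance_noise.
set V := charge_integral xi _; set A := charge_integral xi f => h.
rewrite /estimation_risk -/V -/A -subr_ge0.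
have -> : (A - th) ^+ 2 + V - th ^+ 2 / (1 + c) =
    (A - th + la) ^+ 2 + (V + (- 2 * la * A + la ^+ 2 * c)).
  by rewrite /la; field.
by rewrite addr_ge0// sqr_ge0.
Qed.

End random_integral.

(** * Parseval's identity and the integrated squared error *)

Section parseval.
Context {R : realType}.
Notation mu := (@lebesgue_measure R).
Implicit Types (g h : R -> R) (phi : nat -> R -> R) (c : nat -> R).
Local Open Scope ereal_scope.

Let mI := @measurable_I01 R.

(** Replaces the triangle inequality in L2: it lets norms be compared in the
    extended reals, without square roots and before finiteness is known. *)
Lemma lee_of_young (x y : \bar R) : 0 <= y ->
  (forall e dl : R, (0 < e)%R -> (0 < dl)%R ->
     x <= (1 + e)%:E * y + (1 + e^-1)%:E * dl%:E) -> x <= y.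
Proof.
case: y => [b| |] // b0 H; last by rewrite leey.
apply/lee_addgt0Pr => n n0; rewrite lee_fin in b0.
pose e := (n / (2 * (b + 1)))%R.
have b1 : (0 < b + 1)%R by lra.
have e0 : (0 < e)%R by rewrite /e divr_gt0// mulr_gt0.
have e1 : (0 < 1 + e^-1)%R by rewrite addr_gt0// invr_gt0.
pose dl := (n / (2 * (1 + e^-1)))%R.
have dl0 : (0 < dl)%R by rewrite /dl divr_gt0// mulr_gt0.
apply: (le_trans (H e dl e0 dl0)).
rewrite -!EFinM -!EFinD lee_fin.
have -> : ((1 + e^-1) * dl = n / 2)%R.
  by rewrite /dl; field; rewrite !gt_eqF//; lra.
have : (e * b <= n / 2)%R.
  rewrite /e mulrAC ler_pdivrMr ?mulr_gt0//; nra.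
lra.
Qed.

Lemma le_integral_sqr_young g h (e : R) : (0 < e)%R ->
  measurable_fun I01 g -> measurable_fun I01 h ->
  \int[mu]_(t in I01) (g t ^+ 2)%:E <=
    (1 + e)%:E * \int[mu]_(t in I01) (h t ^+ 2)%:E + (1 + e^-1)%:E * sqdist01 g h.
Proof.
move=> e0 mg mh; have ei : (0 < e^-1)%R by rewrite invr_gt0.
have mg2 : measurable_fun I01 (EFin \o (fun t => g t ^+ 2)%R).
  by apply/measurable_EFinP; exact: measurable_funX.
have mh2 : measurable_fun I01 (EFin \o (fun t => h t ^+ 2)%R).
  by apply/measurable_EFinP; exact: measurable_funX.
have md2 : measurable_fun I01 (EFin \o (fun t => (g t - h t) ^+ 2)%R).
  by apply/measurable_EFinP; apply: measurable_funX; exact: measurable_funB.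
rewrite /sqdist01 -!ge0_integralZl//; try (by move=> t _; rewrite lee_fin sqr_ge0);
  try (by rewrite lee_fin addr_ge0// ltW).
rewrite -ge0_integralD//; last 4 first.
- by move=> t _; rewrite mule_ge0// lee_fin ?sqr_ge0// addr_ge0// ltW.
- exact: measurable_funeM.
- by move=> t _; rewrite mule_ge0// lee_fin ?sqr_ge0// addr_ge0// ltW.
- exact: measurable_funeM.
apply: ge0_le_integral => //.
- by move=> t _; rewrite lee_fin sqr_ge0.
- by apply: emeasurable_funD; exact: measurable_funeM.
- move=> t _; rewrite -!EFinM -EFinD lee_fin.
  rewrite -subr_ge0 (_ : _ - _ = e^-1 * ((g t - h t) - e * h t) ^+ 2)%R.
    by rewrite mulr_ge0 ?sqr_ge0// ltW.
  by field; rewrite gt_eqF.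
Qed.

Lemma sqdist01C g h : sqdist01 g h = sqdist01 h g.
Proof. by apply: eq_integral => t _; rewrite -sqrrN opprB. Qed.

Lemma sqdist01_ge0 g h : 0 <= sqdist01 g h.
Proof. by apply: integral_ge0 => t _; rewrite lee_fin sqr_ge0. Qed.

Lemma cvge0_near (D : nat -> \bar R) (dl : R) : D n @[n --> \oo] --> 0 ->
  (0 < dl)%R -> \forall n \near \oo, D n < dl%:E.
Proof.
move=> D0 dl0; have : nbhs (0 : \bar R) [set y | y < dl%:E].
  by apply: open_nbhs_nbhs; split; [exact: open_ereal_lt_ereal|rewrite /= lte_fin].
by move/D0.
Qed.

(** Continuity of the squared norm under L2-convergence. As the norms of the
    [S n] increase, each of them is compared with the limit through a later index
    at which the distance is already small. *)
Lemma cvg_integral_sqr g (S : nat -> R -> R) (a : nat -> R) :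
  measurable_fun I01 g -> (forall n, measurable_fun I01 (S n)) ->
  (forall n, 0 <= (a n)%:E) ->
  (forall n, \int[mu]_(t in I01) (S n t ^+ 2)%:E = \sum_(j < n) (a j)%:E) ->
  sqdist01 g (S n) @[n --> \oo] --> 0 ->
  \int[mu]_(t in I01) (g t ^+ 2)%:E = \sum_(0 <= j <oo) (a j)%:E.
Proof.
move=> mg mS a0 Sa D0.
have g0 : 0 <= \int[mu]_(t in I01) (g t ^+ 2)%:E.
  by apply: integral_ge0 => t _; rewrite lee_fin sqr_ge0.
have L0 : 0 <= \sum_(0 <= j <oo) (a j)%:E by apply: nneseries_ge0.
have aL n : \sum_(j < n) (a j)%:E <= \sum_(0 <= j <oo) (a j)%:E.
  by rewrite -(big_mkord xpredT (fun j => (a j)%:E)); exact: nneseries_lim_ge.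
apply/eqP; rewrite eq_le; apply/andP; split.
- apply: lee_of_young => // e dl e0 dl0.
  have [N _ /(_ N (leqnn N)) DN] := cvge0_near D0 dl0.
  have e1 : (0 <= 1 + e)%R by rewrite addr_ge0// ltW.
  have ei : (0 <= 1 + e^-1)%R by rewrite addr_ge0// invr_ge0 ltW.
  apply: (le_trans (le_integral_sqr_young e0 mg (mS N))).
  by apply: leeD; apply: lee_wpmul2l; rewrite ?lee_fin// ?Sa// ltW.
- apply: lime_le; first by apply: is_cvg_nneseries.
  apply: nearW => k; apply: lee_of_young => // e dl e0 dl0.
  have [N _ DN] := cvge0_near D0 dl0.
  have /DN {}DN : (N <= maxn N k)%N by rewrite leq_maxl.
  have e1 : (0 <= 1 + e)%R by rewrite addr_ge0// ltW.
  have ei : (0 <= 1 + e^-1)%R by rewrite addr_ge0// invr_ge0 ltW.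
  apply: (@le_trans _ _ (\sum_(j < maxn N k) (a j)%:E)).
    rewrite big_mkord -!(big_mkord xpredT (fun j => (a j)%:E)).
    rewrite [leRHS](big_cat_nat (n := k))//= ?leq_maxr// leeDl//.
    by apply: sume_ge0.
  rewrite -Sa; apply: (le_trans (le_integral_sqr_young e0 (mS _) mg)).
  by apply: leeD => //; apply: lee_wpmul2l; rewrite ?lee_fin// sqdist01C ltW.
Qed.

Lemma L2P g : L2 g <-> square_integrable mu I01 g.
Proof.
split=> -[mg ig]; split => //.
  apply/integrableP; split; first by apply/measurable_EFinP; exact: measurable_funX.
  by under eq_integral do rewrite /= ger0_norm ?sqr_ge0//.
case/integrableP : ig => _; apply: le_lt_trans; rewrite le_eqVlt; apply/orP; left; apply/eqP.
by apply: eq_integral => t _; rewrite /= ger0_norm ?sqr_ge0.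
Qed.

Lemma lebesgue_measure_I01 : mu I01 = 1.
Proof. by rewrite /I01 lebesgue_measure_itv/= lte_fin ltr01 oppr0 adde0. Qed.

Definition partial_sum phi c (n : nat) (t : R) : R := (\sum_(j < n) c j * phi j t)%R.

Lemma partial_sumS phi c n t :
  partial_sum phi c n.+1 t = (partial_sum phi c n t + c n * phi n t)%R.
Proof. by rewrite /partial_sum big_ord_recr. Qed.

Section basis.
Variable phi : nat -> R -> R.
Hypothesis phi_basis : orthonormal_basis phi.

Let iphi j : square_integrable mu I01 (phi j).
Proof. by apply/L2P; case: phi_basis => h _ _; exact: h. Qed.

Lemma square_integrable_partial_sum c n : square_integrable mu I01 (partial_sum phi c n).
Proof.
elim: n => [|n IH].
  rewrite (_ : partial_sum _ _ _ = cst 0%R).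
    by apply: square_integrable_cst => //; rewrite [X in X < _]lebesgue_measure_I01 ltry.
  by apply/funext => t; rewrite /partial_sum big_ord0.
rewrite (funext (partial_sumS phi c n)).
by apply: square_integrableD => //; exact: square_integrableZ.
Qed.

Lemma inner_partial_sum c n k : (n <= k)%N -> inner01 (partial_sum phi c n) (phi k) = 0%R.
Proof.
elim: n => [|n IH] nk.
  rewrite /inner01 /Rintegral integral0_eq// => t _.
  by rewrite /partial_sum big_ord0 mul0r.
rewrite /inner01.
under eq_Rintegral do rewrite partial_sumS mulrDl -mulrA.
have i1 := square_integrableM mI (square_integrable_partial_sum c n) (iphi k).
have i2 := square_integrableM mI (iphi n) (iphi k).
rewrite (RintegralD mI i1 (integrableZl mI (c n) i2)) (RintegralZl _ mI i2).
rewrite -/(inner01 _ _) -/(inner01 (phi n) (phi k)) (IH (ltnW nk)) add0r.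
by case: phi_basis => _ -> _; rewrite ltn_eqF// mulr0.
Qed.

Lemma integral_sqr_partial_sum c n :
  \int[mu]_(t in I01) (partial_sum phi c n t ^+ 2)%:E = \sum_(j < n) (c j ^+ 2)%:E.
Proof.
elim: n => [|n IH].
  rewrite big_ord0 integral0_eq// => t _.
  by rewrite /partial_sum big_ord0 expr0n.
have iS := square_integrable_partial_sum c n.
rewrite big_ord_recr/= -IH.
have i1 := iS.2; have i2 := square_integrableM mI iS (iphi n); have i3 := (iphi n).2.
rewrite -(fineK (integrable_fin_num mI (square_integrable_partial_sum c n.+1).2)).
rewrite -(fineK (integrable_fin_num mI i1)) -EFinD; congr EFin.
rewrite -[LHS]/(\int[mu]_(t in I01) (partial_sum phi c n.+1 t ^+ 2))%R.
rewrite -[X in _ = (X + _)%R]/(\int[mu]_(t in I01) (partial_sum phi c n t ^+ 2))%R.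
transitivity (\int[mu]_(t in I01) (partial_sum phi c n t ^+ 2 +
   ((2 * c n) * (partial_sum phi c n t * phi n t) + c n ^+ 2 * phi n t ^+ 2)))%R.
  by apply: eq_Rintegral => t _; rewrite partial_sumS; ring.
have i2' := integrableZl mI (2 * c n)%R i2; have i3' := integrableZl mI (c n ^+ 2)%R i3.
rewrite (RintegralD mI i1 (integrableD mI i2' i3')) (RintegralD mI i2' i3').
rewrite (RintegralZl _ mI i2) (RintegralZl _ mI i3).
rewrite -[X in (_ * X + _)%R]/(inner01 (partial_sum phi c n) (phi n)) inner_partial_sum// mulr0 add0r.
have nn : (\int[mu]_(x in I01) phi n x ^+ 2)%R = 1%R.
  have [_ h _] := phi_basis; have := h n n; rewrite eqxx => h1.
  by rewrite -[RHS]h1; apply: eq_Rintegral => t _; rewrite expr2.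
by rewrite nn mulr1.
Qed.

(** The squared norm of each partial sum is the partial sum of the [c j ^+ 2], by
    orthonormality, and it passes to the L2-limit. *)
Theorem parseval g c : measurable_fun I01 g ->
  sqdist01 g (partial_sum phi c n) @[n --> \oo] --> 0 ->
  \int[mu]_(t in I01) (g t ^+ 2)%:E = \sum_(0 <= j <oo) (c j ^+ 2)%:E.
Proof.
move=> mg; apply: cvg_integral_sqr => //.
- by move=> n; exact: (square_integrable_partial_sum c n).1.
- by move=> n; rewrite lee_fin sqr_ge0.
- exact: integral_sqr_partial_sum.
Qed.

Lemma cvg_theta f : L2 f ->
  sqdist01 f (partial_sum phi (theta f phi) n) @[n --> \oo] --> 0.
Proof. by case: phi_basis => _ _; exact. Qed.

End basis.

Lemma sqdist01B_le g1 g2 h1 h2 :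
  measurable_fun I01 g1 -> measurable_fun I01 g2 ->
  measurable_fun I01 h1 -> measurable_fun I01 h2 ->
  sqdist01 (fun t => g1 t - g2 t)%R (fun t => h1 t - h2 t)%R <=
    2%:E * sqdist01 g1 h1 + 2%:E * sqdist01 g2 h2.
Proof.
move=> mg1 mg2 mh1 mh2.
have md g h : measurable_fun I01 g -> measurable_fun I01 h ->
    measurable_fun I01 (EFin \o (fun t => (g t - h t) ^+ 2)%R).
  by move=> *; apply/measurable_EFinP/measurable_funX/measurable_funB.
rewrite /sqdist01 -!ge0_integralZl//; [|exact: md| |exact: md|];
  try (by move=> t _; rewrite lee_fin sqr_ge0).
rewrite -ge0_integralD//; last 4 first.
- by move=> t _; rewrite mule_ge0// lee_fin sqr_ge0.
- by apply: measurable_funeM; exact: md.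
- by move=> t _; rewrite mule_ge0// lee_fin sqr_ge0.
- by apply: measurable_funeM; exact: md.
apply: ge0_le_integral => //.
- by move=> t _; rewrite lee_fin sqr_ge0.
- by apply: md; exact: measurable_funB.
- by apply: emeasurable_funD; apply: measurable_funeM; exact: md.
- move=> t _; rewrite -!EFinM -EFinD lee_fin.
  have := sqr_ge0 ((g1 t - h1 t) + (g2 t - h2 t)); nra.
Qed.

Lemma cvg_sqdist01B g1 g2 (S1 S2 : nat -> R -> R) :
  measurable_fun I01 g1 -> measurable_fun I01 g2 ->
  (forall n, measurable_fun I01 (S1 n)) -> (forall n, measurable_fun I01 (S2 n)) ->
  sqdist01 g1 (S1 n) @[n --> \oo] --> 0 -> sqdist01 g2 (S2 n) @[n --> \oo] --> 0 ->
  sqdist01 (fun t => g1 t - g2 t)%R (fun t => S1 n t - S2 n t)%R @[n --> \oo] --> 0.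
Proof.
move=> mg1 mg2 mS1 mS2 c1 c2.
apply: (@squeeze_cvge _ _ _ _ (cst 0) _
  (fun n => 2%:E * sqdist01 g1 (S1 n) + 2%:E * sqdist01 g2 (S2 n))).
- by near=> n; rewrite sqdist01_ge0 sqdist01B_le.
- exact: cvg_cst.
- rewrite -[X in _ --> X]add0e -[X in _ --> X + _](mule0 2%:E) -[X in _ --> _ + X](mule0 2%:E).
  by apply: cvgeD; [rewrite !mule0|exact: cvgeZl|exact: cvgeZl].
Unshelve. all: by end_near. Qed.

Lemma sqdist01Zl (a : R) g h : measurable_fun I01 g -> measurable_fun I01 h ->
  sqdist01 (fun t => a * g t)%R (fun t => a * h t)%R = (a ^+ 2)%:E * sqdist01 g h.
Proof.
move=> mg mh; rewrite /sqdist01 -ge0_integralZl//; last 3 first.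
- by apply/measurable_EFinP/measurable_funX/measurable_funB.
- by move=> t _; rewrite lee_fin sqr_ge0.
- by rewrite lee_fin sqr_ge0.
by apply: eq_integral => t _; rewrite -EFinM -mulrBr exprMn.
Qed.

Lemma measurable_path_ge0_integral {d : measure_display} {T : measurableType d}
    (Y : R -> T -> R) : jointly_measurable01 Y -> (forall t w, (0 <= Y t w)%R) ->
  measurable_fun setT (fun w => \int[mu]_(t in I01) (Y t w)%:E).
Proof.
move=> mY Y0.
have mE : measurable_fun setT (EFin \o extend01 Y).
  by apply/measurable_EFinP; exact: measurable_extend01.
have E0 x : 0 <= (EFin \o extend01 Y) x.
  by rewrite /= lee_fin /extend01 patchE; case: ifPn.
have := @measurable_fun_fubini_tonelli_G _ _ _ _ _ mu _ mE E0.
congr measurable_fun; apply/funext => w; rewrite [RHS]integral_mkcond.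
apply: eq_integral => t _; move: t; apply/funeqP; exact: extend01_section.
Qed.

End parseval.

Section mise.
Context {R : realType} {d : measure_display} {T : measurableType d}.
Variables (P : probability T R) (f : R -> R) (K : R -> R -> R) (eps : R -> T -> R).
Variable phi : nat -> R -> R.
Hypothesis phi_basis : orthonormal_basis phi.
Hypothesis eps_meas : jointly_measurable01 eps.
Hypothesis f_L2 : L2 f.
Notation mu := (@lebesgue_measure R).

Let mf : measurable_fun I01 f := f_L2.1.

Lemma measurable_theta_hat xi j : measurable_fun setT (theta_hat f eps xi j).
Proof.
by apply: measurable_charge_integral; exact: jointly_measurable_observation.
Qed.

(** For almost every outcome [fhat - f] is the sum of a series with coefficients
    [theta_hat j - theta j], so Parseval's identity applies path by path; taking
    expectations exchanges with the sum of nonnegative terms. *)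
Lemma MISE_eq_coefficient_risk xi fhat : linear_estimator P f K eps phi xi fhat ->
  MISE P f fhat = coefficient_risk P f eps phi xi.
Proof.
move=> [_ mfhat cfhat]; rewrite /MISE /coefficient_risk.
have mth j : measurable_fun setT (fun w => ((theta_hat f eps xi j w - theta f phi j) ^+ 2)%:E).
  apply/measurable_EFinP/measurable_funX/measurable_funB => //.
  exact: measurable_theta_hat.
transitivity (\int[P]_w (\sum_(0 <= j <oo) ((theta_hat f eps xi j w - theta f phi j) ^+ 2)%:E))%E.
  apply: ae_eq_integral => //.
  - apply: (measurable_path_ge0_integral (Y := fun t w => (fhat t w - f t) ^+ 2)).
      apply: measurable_funX; apply: measurable_funB => //.
      exact: jointly_measurable_time.
    by move=> t w; exact: sqr_ge0.
  - apply: ge0_emeasurable_sum => // j w _ _; exact: sqr_ge0.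
  - move: cfhat; apply: filterS => w cw _.
    have mw : measurable_fun I01 (fhat ^~ w) := measurable_path w mfhat.
    apply: (parseval phi_basis (c := fun j => theta_hat f eps xi j w - theta f phi j)).
      exact: measurable_funB.
    have mS c n := (square_integrable_partial_sum phi_basis c n).1.
    have h := cvg_sqdist01B mw mf (mS (fun j => theta_hat f eps xi j w))
      (mS (theta f phi)) cw (cvg_theta phi_basis f_L2).
    apply: cvg_trans h; apply: near_eq_cvg; apply: nearW => n.
    apply: eq_integral => t _; rewrite /partial_sum -sumrB.
    under [in RHS]eq_bigr do rewrite mulrBl.
    by [].
rewrite integral_nneseries//; last by move=> j w _; rewrite lee_fin sqr_ge0.
by apply: eq_eseriesr => j _; rewrite unlock.
Qed.

End mise.

(** * The integral equation solved by the oracle measure *)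

Lemma bounded_measurable01_lebesgue_integrable {R : realType} (g : R -> R) :
  bounded_measurable01 g -> (@lebesgue_measure R).-integrable I01 (EFin \o g).
Proof.
move=> bg; apply: measurable_bounded_integrable.
- exact: measurable_I01.
- by rewrite [X in (X < _)%E]lebesgue_measure_I01 ltry.
- exact: bg.1.
- exact: bounded_measurable01_boundedP.
Qed.

Lemma bounded_measurable01_L2 {R : realType} (g : R -> R) : bounded_measurable01 g -> L2 g.
Proof.
move=> bg; apply/L2P; split; first exact: bg.1.
apply: bounded_measurable01_lebesgue_integrable.
have := bounded_measurable01M bg bg.
by congr bounded_measurable01; apply/funext => t; rewrite expr2.
Qed.

Lemma bounded_measurable01_triangular_kernel {R : realType} (u v : R -> R) t :
  bounded_measurable01 u -> bounded_measurable01 v -> I01 t ->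
  bounded_measurable01 (fun s => triangular_kernel u v s t).
Proof.
move=> [mu [A uA]] [mv [B vB]] It.
have E s : triangular_kernel u v s t = u (Num.min s t) * v (Num.max s t).
  rewrite /triangular_kernel; by have [st|st] := leP s t.
have Imin s : I01 s -> I01 (Num.min s t) by rewrite minElt; case: ifP.
have Imax s : I01 s -> I01 (Num.max s t) by rewrite maxElt; case: ifP.
split.
  rewrite (funext E); apply: measurable_funM.
  - apply: (@measurable_comp _ _ _ _ _ _ I01 u) => //.
    + exact: measurable_I01.
    + by move=> _ [s Is <-]; exact: Imin.
    + by apply: measurable_minr => //; exact: measurable_id.
  - apply: (@measurable_comp _ _ _ _ _ _ I01 v) => //.
    + exact: measurable_I01.
    + by move=> _ [s Is <-]; exact: Imax.
    + by apply: measurable_maxr => //; exact: measurable_id.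
exists (A * B) => s Is; rewrite E normrM ler_pM//; [exact/uA/Imin|exact/vB/Imax].
Qed.

Section oracle_equations.
Context {R : realType}.
Notation mu := (@lebesgue_measure R).
Notation MR := (measurableTypeR R).
Variables f u v : R -> R.
Hypothesis f_diff : twice_differentiable01 f.
Hypothesis u_diff : twice_differentiable01 u.
Hypothesis v_diff : twice_differentiable01 v.
Hypothesis v_neq0 : forall t, I01 t -> v t != 0.
Hypothesis q_ge0 : forall t, I01 t -> 0 <= q u v t.
Hypothesis q_nd : forall s t, I01 s -> I01 t -> s <= t -> q u v s <= q u v t.
Hypothesis notC : ~~ caseC f u.
Hypothesis q'0 : u 0 != 0 -> deriv01 (q u v) 0 != 0.
Hypothesis q'_neq0 : forall t, 0 < t <= 1 -> deriv01 (q u v) t != 0.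
Hypothesis p_int : mu.-integrable I01 (EFin \o p_oracle f u v).

Notation Q := (q u v).
Notation F := (f_over_v f v).
Notation Q' := (deriv01 Q).
Notation F' := (deriv01 F).
(** The function [h = F' / q'] carries the oracle measure: its density is
    [- h' / v], and its endpoint values determine the two atoms. *)
Let h s := F' s * (Q' s)^-1.
Notation h' := (deriv01 h).
Let mI := @measurable_I01 R.

Let I0 : I01 (0 : R). Proof. by apply/I01P; rewrite lexx ler01. Qed.
Let I1 : I01 (1 : R). Proof. by apply/I01P; rewrite lexx ler01. Qed.

Let Q_diff : twice_differentiable01 Q. Proof. exact: twice_differentiable01_div. Qed.
Let F_diff : twice_differentiable01 F. Proof. exact: twice_differentiable01_div. Qed.

Let f0_eq0 : u 0 = 0 -> f 0 = 0.
Proof. by move=> u0; apply/eqP; move: notC; rewrite /caseC u0 eqxx/= negbK. Qed.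

Let is_deriv_h (t : R) : I01 t -> Q' t != 0 -> is_deriv01 h t (h' t).
Proof.
move=> It Qt; have dF := F_diff.2 t It; have dQ := Q_diff.2 t It.
exact: is_deriv01_derivable (is_deriv01M dF (is_deriv01V It Qt dQ)).
Qed.

Let h'E t : I01 t -> h' t = - v t * p_oracle f u v t.
Proof.
move=> It; rewrite /p_oracle (negbTE notC) mulrA mulrNN mulfV ?v_neq0// mul1r.
by [].
Qed.

Let bv : bounded_measurable01 v.
Proof. exact: continuous_bounded_measurable01 (twice_differentiable01_continuous v_diff).1. Qed.

Let ih' : mu.-integrable I01 (EFin \o h').
Proof.
have bNv : bounded_measurable01 (fun t => - v t).
  split; first exact: measurableT_comp bv.1.
  by have [_ [M vM]] := bv; exists M => t It; rewrite normrN vM.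
have := integrableMr mI bNv.1 (bounded_measurable01_boundedP bNv) p_int.
apply: eq_integrable => // t /set_mem It.
by rewrite /comp h'E// EFinM.
Qed.

(** When [u 0 = 0] the derivative of [q] may vanish at 0, and [h 0] is then
    meaningless. Since [h'] is integrable, [h] nevertheless has a limit at 0, and
    [H] is the resulting continuous function; it agrees with [h] on ]0,1]. *)
Let H x := h 1 - \int[mu]_(t in `[0, 1]) h' t + \int[mu]_(t in `[0, x]) h' t.

Let H_continuous : {within `[0, 1], continuous H}.
Proof.
move=> x; apply: cvgD; first exact: cvg_cst.
exact: (parameterized_integral_continuous ler01 ih').
Qed.

Let FTC_h (a : R) : 0 <= a <= 1 -> (a = 0 -> Q' 0 != 0) ->
  \int[mu]_(t in `[a, 1]) h' t = h 1 - h a.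
Proof.
move=> /andP[a0 a1] aQ.
have Qt t : a <= t <= 1 -> Q' t != 0.
  move=> /andP[at_ t1]; move: (le_trans a0 at_); rewrite le_eqVlt => /predU1P[t0|t0].
    by rewrite -t0; apply: aQ; apply/eqP; rewrite eq_le a0 andbT t0.
  by apply: q'_neq0; rewrite t0.
apply: integral_derive => //.
- apply: (@is_deriv01_within_continuous _ h h') => // t tab.
  apply: is_deriv_h; last exact: Qt.
  by case/andP: tab => ? ?; apply/I01P/andP; split; lra.
- move=> t /andP[at_ t1]; apply: is_deriv01_is_derive; first by apply/andP; split; lra.
  apply: is_deriv_h; last by apply: Qt; rewrite !ltW.
  by apply/I01P/andP; split; lra.
- apply: integrableS ih' => //.
  by apply: subset_itvr; rewrite bnd_simp.
Qed.

Let HE (x : R) : I01 x -> 0 < x -> H x = h x.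
Proof.
move=> Ix x0; have /I01P/andP[_ x1] := Ix.
have E : \int[mu]_(t in `[x, 1]) h' t = h 1 - h x.
  by apply: FTC_h => [|x00]; [rewrite ltW|rewrite x00 ltxx in x0].
have B : \int[mu]_(t in `[0, 1]) h' t - \int[mu]_(t in `[0, x]) h' t =
    \int[mu]_(t in `[x, 1]) h' t.
  rewrite -[RHS]Rintegral_itv_obnd_cbnd; last first.
    by apply: integrableS ih' => //; apply: subset_itvr; rewrite bnd_simp ltW.
  by apply: Rintegral_itvB => //; rewrite bnd_simp// ltW.
by move: B; rewrite E /H; lra.
Qed.

Let H0 : u 0 != 0 -> H 0 = h 0.
Proof.
move=> u0; rewrite /H set_itv1 Rintegral_set1 addr0 FTC_h; [ring|by rewrite lexx ler01|].
by move=> _; exact: q'0.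
Qed.

Let is_derive_H (t : R) : 0 < t < 1 -> is_derive t 1 H (h' t).
Proof.
move=> t01; have /andP[t0 t1] := t01.
have It : I01 t by apply/I01P; rewrite !ltW.
apply: is_deriv01_is_derive => //.
apply: (eq_is_deriv01_pos t0 It _ (is_deriv_h It _)) => [s Is s0|].
  by rewrite HE.
by apply: q'_neq0; rewrite t0 ltW.
Qed.

Let is_derive_Q (t : R) : 0 < t < 1 -> is_derive t 1 Q (Q' t).
Proof.
move=> t01; apply: is_deriv01_is_derive => //; apply/derivable01P/Q_diff.1.
by apply/I01P; have /andP[t0 t1] := t01; rewrite !ltW.
Qed.

Let is_derive_F (t : R) : 0 < t < 1 -> is_derive t 1 F (F' t).
Proof.
move=> t01; apply: is_deriv01_is_derive => //; apply/derivable01P/F_diff.1.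
by apply/I01P; have /andP[t0 t1] := t01; rewrite !ltW.
Qed.

Let cQ := (twice_differentiable01_continuous Q_diff).1.
Let cF := (twice_differentiable01_continuous F_diff).1.
Let cF' := (twice_differentiable01_continuous F_diff).2.

Let bQ : bounded_measurable01 Q. Proof. exact: continuous_bounded_measurable01. Qed.
Let bF : bounded_measurable01 F. Proof. exact: continuous_bounded_measurable01. Qed.
Let bF' : bounded_measurable01 F'. Proof. exact: continuous_bounded_measurable01. Qed.
Let bH : bounded_measurable01 H. Proof. exact: continuous_bounded_measurable01. Qed.

Let integrable_mulh' g : bounded_measurable01 g -> mu.-integrable I01 (EFin \o (fun t => g t * h' t)).
Proof.
move=> bg; have := integrableMr mI bg.1 (bounded_measurable01_boundedP bg) ih'.
by apply: eq_integrable => // t _; rewrite /comp EFinM.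
Qed.

Let sub01 (a b : R) : 0 <= a -> b <= 1 -> (`[a, b] : set MR) `<=` I01.
Proof. by move=> a0 b1; apply: subset_itvScc; rewrite bnd_simp. Qed.

Let FTC_H (a b : R) : 0 <= a -> a <= b -> b <= 1 -> \int[mu]_(t in `[a, b]) h' t = H b - H a.
Proof.
move=> a0 ab b1; apply: (@integral_derive _ H h' a b ab).
- exact: continuous_subspaceW (sub01 a0 b1) H_continuous.
- by move=> t /andP[at_ tb]; apply: is_derive_H; apply/andP; split; lra.
- exact: integrableS (sub01 a0 b1) ih'.
Qed.

(** Integration by parts of [q h'], in which [q' h = F'] is an exact derivative. *)
Let FTC_QH (a b : R) : 0 <= a -> a <= b -> b <= 1 ->
  \int[mu]_(t in `[a, b]) (Q t * h' t) = (Q b * H b - F b) - (Q a * H a - F a).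
Proof.
move=> a0 ab b1; apply: (@integral_derive _ (fun t => Q t * H t - F t) _ a b ab).
- apply: continuous_subspaceW (sub01 a0 b1) _ => x.
  by apply: cvgB; [apply: cvgM; [exact: cQ|exact: H_continuous]|exact: cF].
- move=> t /andP[at_ tb]; have t01 : 0 < t < 1 by apply/andP; split; lra.
  have It : I01 t by apply/I01P/andP; split; lra.
  have dQ := is_derive_Q t01; have dH := is_derive_H t01; have dF := is_derive_F t01.
  have Qt : Q' t != 0 by apply: q'_neq0; apply/andP; split; lra.
  have -> : Q t * h' t = Q t *: h' t + H t *: Q' t - F' t.
    rewrite /GRing.scale/= HE//; last by lra.
    by rewrite /h divfK// addrK.
  exact: is_deriveB.
- exact: integrableS (sub01 a0 b1) (integrable_mulh' bQ).
Qed.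

Let FTC_FH : \int[mu]_(t in `[0, 1]) (F t * h' t) + \int[mu]_(t in `[0, 1]) (F' t * H t) =
  F 1 * H 1 - F 0 * H 0.
Proof.
have i1 := integrable_mulh' bF.
have i2 : mu.-integrable I01 (EFin \o (fun t => F' t * H t)).
  exact/bounded_measurable01_lebesgue_integrable/bounded_measurable01M.
have i3 : mu.-integrable I01 (EFin \o (fun t => F t * h' t + F' t * H t)).
  exact: (integrableD mI i1 i2).
rewrite -RintegralD//; apply: (@integral_derive _ (fun t => F t * H t) _ 0 1 ler01).
- by move=> x; apply: cvgM; [exact: cF|exact: H_continuous].
- move=> t t01; have dH := is_derive_H t01; have dF := is_derive_F t01.
  have -> : F t * h' t + F' t * H t = F t *: h' t + H t *: F' t.
    by rewrite /GRing.scale/= [H t * _]mulrC.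
  exact: is_deriveM.
- exact: i3.
Qed.

(** Otherwise [q], which is nonnegative and nondecreasing, would be 0 on all of
    [0,1] and so would its derivative at 1. *)
Let u1_neq0 : u 1 != 0.
Proof.
apply/eqP => u1; have Q1 : Q 1 = 0 by rewrite /q u1 mul0r.
have Q0 t : I01 t -> Q t = 0.
  move=> It; apply/eqP; rewrite eq_le q_ge0// andbT -Q1; apply: q_nd => //.
  by move/I01P : It => /andP[].
have : deriv01 Q 1 = 0.
  apply: is_deriv01E => //; apply: (eq_is_deriv01 I1 _ (is_deriv01_cst 0 1)) => s Is.
  by rewrite Q0.
by apply/eqP/q'_neq0; rewrite ltr01 lexx.
Qed.

Let vP1 : v 1 * P1_oracle f u v = H 1.
Proof.
have v1 := v_neq0 I1; have u1 := u1_neq0; have Q1 : Q' 1 != 0 by apply: q'_neq0; rewrite ltr01 lexx.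
rewrite /P1_oracle (negbTE notC) HE// /h {2}/q.
by field; rewrite u1 v1 Q1.
Qed.

(** Both sides vanish when [u 0 = 0], as then [q 0 = 0] and [f 0 = 0]. *)
Let vP0Q : v 0 * P0_oracle f u v * Q 0 = F 0 - Q 0 * H 0.
Proof.
have v0 := v_neq0 I0; have [u0|u0] := eqVneq (u 0) 0.
  by rewrite /q /f_over_v u0 f0_eq0// !mul0r !mulr0 subr0.
rewrite H0// /P0_oracle (negbTE notC) (negbTE u0) /h.
have df := f_diff.1 0 I0; have du := u_diff.1 0 I0; have dv := v_diff.1 0 I0.
have EQ : Q' 0 = (deriv01 u 0 * v 0 - u 0 * deriv01 v 0) / v 0 ^+ 2.
  exact: is_deriv01E (is_deriv01_div I0 v0 du dv).
have EF : F' 0 = (deriv01 f 0 * v 0 - f 0 * deriv01 v 0) / v 0 ^+ 2.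
  exact: is_deriv01E (is_deriv01_div I0 v0 df dv).
have EG : deriv01 (fun t => f t / u t) 0 = (deriv01 f 0 * u 0 - f 0 * deriv01 u 0) / u 0 ^+ 2.
  exact: is_deriv01E (is_deriv01_div I0 u0 df du).
have := q'0 u0; rewrite EG EF EQ => q0.
rewrite /q /f_over_v.
have W0 : deriv01 u 0 * v 0 - u 0 * deriv01 v 0 != 0.
  by apply: contraNneq q0 => ->; rewrite mul0r.
by field; rewrite u0 v0 W0.
Qed.

Notation P0 := (P0_oracle f u v).
Notation P1 := (P1_oracle f u v).
Notation p := (p_oracle f u v).

(** The kernel is [v(s) v(t) q(min(s, t))]. Splitting the integral at [t] and
    integrating by parts, the density contributes [f(t)] plus boundary terms at 0
    and 1, and the atoms are exactly what cancels these. *)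
Lemma oracle_kernel_equation t : I01 t ->
  P0 * triangular_kernel u v 0 t + P1 * triangular_kernel u v 1 t +
  \int[mu]_(s in I01) (triangular_kernel u v s t * p s) = f t.
Proof.
move=> It; have /I01P/andP[t0 t1] := It.
have Kl s : I01 s -> s <= t -> triangular_kernel u v s t * p s = - v t * (Q s * h' s).
  move=> Is st; rewrite /triangular_kernel st h'E// /q; field; exact: v_neq0.
have Kr s : I01 s -> t <= s -> triangular_kernel u v s t * p s = - u t * h' s.
  move=> Is; rewrite le_eqVlt => /predU1P[<-|ts].
    by rewrite Kl// /q; field; exact: v_neq0.
  by rewrite /triangular_kernel leNgt ts/= h'E//; ring.
have iQ : mu.-integrable I01 (EFin \o (fun s => Q s * h' s)) by exact: integrable_mulh'.
have sub1 : (`[0, t] : set MR) `<=` I01 by exact: sub01.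
have sub2 : (`]t, 1] : set MR) `<=` I01.
  by move=> s; rewrite /= in_itv/= => /andP[ts s1]; apply/I01P/andP; split; lra.
have iK : mu.-integrable I01 (EFin \o (fun s => triangular_kernel u v s t * p s)).
  have bu := continuous_bounded_measurable01 (twice_differentiable01_continuous u_diff).1.
  have bK := bounded_measurable01_triangular_kernel bu bv It.
  have := integrableMr mI bK.1 (bounded_measurable01_boundedP bK) p_int.
  by apply: eq_integrable => // s _; rewrite /comp EFinM.
have split_int : \int[mu]_(s in I01) (triangular_kernel u v s t * p s) =
    \int[mu]_(s in `[0, t]) (triangular_kernel u v s t * p s) +
    \int[mu]_(s in `]t, 1]) (triangular_kernel u v s t * p s).
  rewrite -(Rintegral_itvB (a := BLeft 0) (b := BRight 1) (x := t) iK) ?bnd_simp//.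
  by rewrite subrKC.
have E1 : \int[mu]_(s in `[0, t]) (triangular_kernel u v s t * p s) =
    - v t * ((Q t * H t - F t) - (Q 0 * H 0 - F 0)).
  rewrite -(FTC_QH (lexx 0) t0 t1) -RintegralZl//; last exact: integrableS sub1 iQ.
  apply: eq_Rintegral => s /set_mem; rewrite /= in_itv/= => /andP[s0 st].
  by apply: Kl => //; apply/I01P/andP; split; lra.
have E2 : \int[mu]_(s in `]t, 1]) (triangular_kernel u v s t * p s) = - u t * (H 1 - H t).
  rewrite -(FTC_H t0 t1 (lexx 1)) -[X in _ * X]Rintegral_itv_obnd_cbnd; last first.
    exact: integrableS sub2 ih'.
  rewrite -RintegralZl//; last exact: integrableS sub2 ih'.
  apply: eq_Rintegral => s /set_mem; rewrite /= in_itv/= => /andP[ts s1].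
  by apply: Kr; [apply/I01P/andP; split; lra|exact: ltW].
rewrite split_int E1 E2.
have K0 : triangular_kernel u v 0 t = v 0 * Q 0 * v t.
  by rewrite /triangular_kernel t0 /q; field; exact: v_neq0.
have K1 : triangular_kernel u v 1 t = v 1 * u t.
  rewrite /triangular_kernel; have [t1'|//] := leP 1 t; last by rewrite mulrC.
  have -> : t = 1 by lra.
  exact: mulrC.
have -> : P0 * triangular_kernel u v 0 t = (v 0 * P0 * Q 0) * v t by rewrite K0; ring.
have -> : P1 * triangular_kernel u v 1 t = (v 1 * P1) * u t by rewrite K1; ring.
rewrite vP0Q vP1.
have uQ : u t = v t * Q t by rewrite /q; field; exact: v_neq0.
have fF : f t = v t * F t by rewrite /f_over_v; field; exact: v_neq0.
by rewrite uQ fF; ring.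
Qed.

Let FH := \int[mu]_(t in `[0, 1]) (F' t * H t).

(** The integrand is [F' H] except possibly at 0. *)
Lemma integral_c_integrand :
  (\int[mu]_(t in I01) (c_integrand f u v t)%:E = FH%:E)%E.
Proof.
have iFH : mu.-integrable I01 (EFin \o (fun t => F' t * H t)).
  exact/bounded_measurable01_lebesgue_integrable/bounded_measurable01M.
have sub : (`]0, 1] : set MR) `<=` I01.
  by move=> s; rewrite /= in_itv/= => /andP[s0 s1]; apply/I01P/andP; split; lra.
have cE t : t \in (`]0, 1]%classic : set MR) -> c_integrand f u v t = F' t * H t.
  move=> /set_mem t01; have := t01; rewrite /= in_itv/= => /andP[t0 t1].
  by rewrite /c_integrand (HE (sub _ t01) t0) /h expr2 mulrA.
have mFH : measurable_fun (`]0, 1] : set MR) (EFin \o (fun t => F' t * H t)).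
  exact: measurable_int (integrableS mI _ sub iFH).
rewrite -[LHS]integral_itv_obnd_cbnd; last first.
  by apply: eq_measurable_fun mFH => t t01; rewrite /comp cE.
under eq_integral => t t01 do rewrite cE//.
rewrite integral_itv_obnd_cbnd//.
by rewrite /FH /Rintegral fineK//; exact: integrable_fin_num.
Qed.

(** Integrating [F h'] by parts turns the density into [\int F' h], the integral
    of [c_integrand]; the atom at 1 cancels the boundary term there, and the
    remaining terms at 0 add up to [F(0)^2 / q(0)]. *)
Lemma oracle_integral_f :
  P0 * f 0 + P1 * f 1 + \int[mu]_(t in I01) (f t * p t) = c_oracle f u v.
Proof.
have E : \int[mu]_(t in I01) (f t * p t) = - \int[mu]_(t in I01) (F t * h' t).
  rewrite -mulN1r -RintegralZl//; last exact: integrable_mulh'.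
  apply: eq_Rintegral => t /set_mem It.
  by rewrite h'E// /f_over_v; field; exact: v_neq0.
have f1 : f 1 = v 1 * F 1 by rewrite /f_over_v; field; exact: v_neq0.
have f0 : f 0 = v 0 * F 0 by rewrite /f_over_v; field; exact: v_neq0.
have cI : \int[mu]_(t in I01) c_integrand f u v t = FH.
  by rewrite /Rintegral integral_c_integrand.
rewrite E; have := FTC_FH; rewrite -/FH -/I01 => EF.
have -> : P1 * f 1 = (v 1 * P1) * F 1 by rewrite f1; ring.
rewrite vP1 /c_oracle (negbTE notC) cI.
have [u0|u0] := eqVneq (u 0) 0.
  have f00 := f0_eq0 u0.
  have F0 : F 0 = 0 by rewrite /f_over_v f00 mul0r.
  by rewrite f00; move: EF; rewrite F0; lra.
have Q0 : Q 0 != 0 by rewrite /q mulf_neq0// invr_neq0// v_neq0.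
have v0 := v_neq0 I0.
have -> : P0 * f 0 = (v 0 * P0 * Q 0) * F 0 / Q 0 by rewrite f0; field.
rewrite vP0Q.
have -> : f 0 ^+ 2 / v 0 ^+ 2 = F 0 ^+ 2 by rewrite f0; field.
have -> : (F 0 - Q 0 * H 0) * F 0 / Q 0 = F 0 ^+ 2 * (Q 0)^-1 - F 0 * H 0 by field.
by move: EF; lra.
Qed.

Lemma c_miseE : c_mise f u v = (c_oracle f u v)%:E.
Proof.
rewrite /c_mise /c_oracle (negbTE notC) /Rintegral integral_c_integrand.
have [u0|u0] := eqVneq (u 0) 0.
  have f00 := f0_eq0 u0.
  by rewrite f00 expr0n/= mul0r mul0e adde0.
have Q0 : Q 0 != 0 by rewrite /q mulf_neq0// invr_neq0// v_neq0.
by rewrite inver (negbTE Q0) -EFinM -EFinD.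
Qed.

End oracle_equations.

(** The monotonicity of [q] makes the integral nonnegative, so that it cannot
    cancel the infinite second term. *)
Lemma c_mise_caseC {R : realType} (f u v : R -> R) :
  v 0 != 0 -> (forall t, I01 t -> derivable01 (q u v) t) ->
  (forall s t, I01 s -> I01 t -> s <= t -> q u v s <= q u v t) ->
  caseC f u -> c_mise f u v = +oo%E.
Proof.
move=> v0 dq nd /andP[/eqP u0 f0]; have q0 : q u v 0 = 0 by rewrite /q u0 mul0r.
rewrite /c_mise q0 inver eqxx.
rewrite gt0_muley ?lte_fin ?divr_gt0 ?exprn_even_gt0//.
rewrite addey// -ltNye; apply: (@lt_le_trans _ _ 0%E) => //.
apply: integral_ge0 => t It; rewrite lee_fin mulr_ge0 ?sqr_ge0// invr_ge0.
exact: deriv01_ge0 (dq t It) nd.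
Qed.

(** * Estimators built on multiples of one signed measure *)

Section scaled_charge_estimator.
Context {R : realType} {d : measure_display} {T : measurableType d}.
Notation MR := (measurableTypeR R).
Notation mu := (@lebesgue_measure R).
Variables (P : probability T R) (f : R -> R) (K : R -> R -> R) (eps : R -> T -> R).
Variables (phi : nat -> R -> R) (M : R).
Hypothesis eps_meas : jointly_measurable01 eps.
Hypothesis eps_sq : forall t, I01 t -> square_integrable P setT (eps t).
Hypothesis eps_cov : forall s t, I01 s -> I01 t ->
  \int[P]_w (eps s w * eps t w) = K s t.
Hypothesis KM : forall t, I01 t -> K t t <= M.
Hypothesis eps_mean : forall t, I01 t -> \int[P]_w eps t w = 0.
Hypothesis phi_basis : orthonormal_basis phi.
Hypothesis bf : bounded_measurable01 f.
Hypothesis bK : forall t, I01 t -> bounded_measurable01 (K ^~ t).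

Variables (nu : {charge set MR -> \bar R}) (c r : R).
Let nuK t := charge_integral nu (fun s => K s t).
Hypothesis bnuK : bounded_measurable01 nuK.
(** [r] is the factor by which the risk of the multiple [th / (1 + c)] of [nu]
    reduces [th ^+ 2]. It is [(1 + c)^-1] when [nu] solves the integral equation
    for [f], and 0 when [nu] observes [f] without noise. *)
Hypothesis risk_nu : forall th : R,
  (th / (1 + c) * charge_integral nu f - th) ^+ 2 +
  (th / (1 + c)) ^+ 2 * charge_integral nu nuK = r * th ^+ 2.
Hypothesis risk_ge : forall xi th, r * th ^+ 2 <= estimation_risk K f xi th.

Let nuK_ge0 : 0 <= charge_integral nu nuK.
Proof. exact: (variance_noise_ge0 eps_meas eps_sq eps_cov KM). Qed.

Let th := theta f phi.
Let xi_star (j : nat) : {charge set MR -> \bar R} := cscale (th j / (1 + c)) nu.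

Let mI := @measurable_I01 R.

Let f_L2 : L2 f. Proof. exact: bounded_measurable01_L2. Qed.

Let star_integral g j : bounded_measurable01 g ->
  charge_integral (xi_star j) g = th j / (1 + c) * charge_integral nu g.
Proof.
by move=> bg; rewrite charge_integral_cscale//; exact: bounded_measurable01_charge_integrable.
Qed.

Let star_variance j :
  charge_integral (xi_star j) (fun t => charge_integral (xi_star j) (fun s => K s t)) =
  (th j / (1 + c)) ^+ 2 * charge_integral nu nuK.
Proof.
rewrite (eq_charge_integral _ (h := fun t => th j / (1 + c) * nuK t)); last first.
  by move=> t It; rewrite star_integral//; exact: bK.
rewrite charge_integralZl; last exact: bounded_measurable01_charge_integrable.
by rewrite star_integral// expr2 mulrA.
Qed.

Let parseval_f : (\int[mu]_(t in I01) (f t ^+ 2)%:E = \sum_(0 <= j <oo) (th j ^+ 2)%:E)%E.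
Proof. exact: parseval bf.1 (cvg_theta phi_basis f_L2). Qed.

Lemma coefficient_riskE xi : coefficient_risk P f eps phi xi =
  (\sum_(0 <= j <oo) (estimation_risk K f (xi j) (th j))%:E)%E.
Proof.
apply: eq_eseriesr => j _; rewrite /theta_hat.
exact: (expectation_estimation eps_meas eps_sq eps_cov KM eps_mean bf).
Qed.

Lemma coefficient_risk_scaled : coefficient_risk P f eps phi xi_star =
  (r%:E * \sum_(0 <= j <oo) (th j ^+ 2)%:E)%E.
Proof.
rewrite coefficient_riskE -nneseriesZl; last by move=> j _; rewrite lee_fin sqr_ge0.
apply: eq_eseriesr => j _; rewrite -EFinM -risk_nu /estimation_risk.
by rewrite star_variance star_integral.
Qed.

Lemma coefficient_risk_scaled_le xi :
  (coefficient_risk P f eps phi xi_star <= coefficient_risk P f eps phi xi)%E.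
Proof.
have r0 : 0 <= r by rewrite -[r]mulr1 -(expr1n _ 2) -risk_nu addr_ge0 ?sqr_ge0// mulr_ge0 ?sqr_ge0.
rewrite coefficient_risk_scaled coefficient_riskE -nneseriesZl; last first.
  by move=> j _; rewrite lee_fin sqr_ge0.
apply: lee_nneseries => j _; first by rewrite -EFinM lee_fin mulr_ge0// sqr_ge0.
by rewrite -EFinM lee_fin; exact: risk_ge.
Qed.

Lemma admissible_scaled : admissible f K xi_star.
Proof.
have th_fin : (\sum_(0 <= j <oo) (th j ^+ 2)%:E < +oo)%E.
  by rewrite -parseval_f; exact: f_L2.2.
have fin (a : nat -> R) (k : R) : 0 <= k -> (forall j, a j = k * th j ^+ 2) ->
    (\sum_(0 <= j <oo) (a j)%:E < +oo)%E.
  move=> k0 aE; under eq_eseriesr do rewrite aE EFinM.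
  rewrite nneseriesZl; last by move=> j _; rewrite lee_fin sqr_ge0.
  by rewrite lte_mul_pinfty ?lee_fin.
apply: lte_add_pinfty.
- apply: (fin _ ((charge_integral nu f / (1 + c)) ^+ 2)) => [|j]; first exact: sqr_ge0.
  by rewrite star_integral//; ring.
- apply: (fin _ (charge_integral nu nuK / (1 + c) ^+ 2)) => [|j].
    by rewrite divr_ge0// sqr_ge0.
  by rewrite star_variance exprMn -exprVn; ring.
Qed.

(** All the coefficients are multiples of one random variable: [theta_hat j] is
    [theta j * X], where [X] is the integral of the observations against [nu]
    divided by [1 + c]. The series therefore sums to [X w * f t]. *)
Lemma exists_scaled_estimator : exists fstar, linear_estimator P f K eps phi xi_star fstar.
Proof.
pose X w := charge_integral nu (fun t => observation f eps t w) / (1 + c).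
have mobs := jointly_measurable_observation bf.1 eps_meas.
have mX : measurable_fun setT X.
  by apply: measurable_funM => //; exact: measurable_charge_integral.
exists (fun t w => X w * f t); split; first exact: admissible_scaled.
  apply: measurable_funM.
    apply: measurable_funTS; exact: measurableT_comp measurable_snd.
  exact: jointly_measurable_time bf.1.
have ae1 := ae_noise_integrable eps_meas eps_sq eps_cov KM nu.
have ae2 : {ae P, forall w j, charge_integrable (xi_star j) (eps ^~ w)}.
  apply/ae_foralln => j; exact: (ae_noise_integrable eps_meas eps_sq eps_cov KM).
have iobs xi w : charge_integrable xi (eps ^~ w) ->
    charge_integrable xi (fun t => observation f eps t w).
  have [bp bn] := bounded_measurable01_charge_integrable xi bf.
  by move=> [ip in_]; split; [exact: (integrableD mI bp ip)|exact: (integrableD mI bn in_)].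
apply: filterS2 ae1 ae2 => w i1 i2.
have E n : sqdist01 (fun t => X w * f t)
    (fun t => \sum_(j < n) theta_hat f eps xi_star j w * phi j t) =
    ((X w ^+ 2)%:E * sqdist01 f (partial_sum phi th n))%E.
  rewrite -sqdist01Zl; [|exact: bf.1|exact: (square_integrable_partial_sum phi_basis th n).1].
  congr sqdist01; apply/funext => t; rewrite /partial_sum mulr_sumr; apply: eq_bigr => j _.
  rewrite /theta_hat charge_integral_cscale; [|exact: iobs|exact: (iobs _ _ (i2 j))].
  by rewrite /X; ring.
rewrite (funext E) -[X in _ --> X](mule0 (X w ^+ 2)%:E).
apply: cvgeZl => //; exact: cvg_theta.
Qed.

End scaled_charge_estimator.

Section oracle.
Context {R : realType} {d : measure_display} {T : measurableType d}.
Notation MR := (measurableTypeR R).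
Notation mu := (@lebesgue_measure R).

Lemma charge_integral_two_atoms_density (a b : R) (p : R -> R)
    (ip : mu.-integrable I01 (EFin \o p)) g : bounded_measurable01 g ->
  charge_integral (cadd (cadd (cscale a (dirac_charge 0)) (cscale b (dirac_charge 1)))
    (density_charge ip)) g = a * g 0 + b * g 1 + \int[mu]_(t in I01) (g t * p t).
Proof.
move=> bg; have ic xi := bounded_measurable01_charge_integrable xi bg.
rewrite charge_integral_cadd// charge_integral_cadd// !charge_integral_cscale//.
rewrite charge_integral_density// !charge_integral_dirac//.
- by apply/I01P; rewrite lexx ler01.
- by apply/I01P; rewrite lexx ler01.
Qed.

(** [q s] is the covariance of [eps s / v s] and [eps t / v t] for [s <= t], so
    [q t - q s] is the variance of the difference of these two variables. *)
Lemma increasing_quotient (P : probability T R) (u v : R -> R) (eps : R -> T -> R) :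
  (forall t, I01 t -> v t != 0) ->
  (forall t, I01 t -> square_integrable P setT (eps t)) ->
  (forall s t, I01 s -> I01 t ->
    \int[P]_w (eps s w * eps t w) = triangular_kernel u v s t) ->
  (forall t, I01 t -> 0 <= q u v t) /\
  (forall s t, I01 s -> I01 t -> s <= t -> q u v s <= q u v t).
Proof.
move=> v0 sq cov.
have covq s t : I01 s -> I01 t -> s <= t ->
    (v s)^-1 * (v t)^-1 * \int[P]_w (eps s w * eps t w) = q u v s.
  move=> Is It st; rewrite cov// /triangular_kernel st /q.
  by field; rewrite !v0.
split=> [t It|s t Is It st].
  rewrite -(covq t t It It (lexx t)) mulr_ge0//; first by rewrite -expr2 sqr_ge0.
  by apply: Rintegral_ge0 => w _; rewrite -expr2 sqr_ge0.
pose a := (v s)^-1; pose b := (v t)^-1.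
have iss := square_integrableM measurableT (sq s Is) (sq s Is).
have ist := square_integrableM measurableT (sq s Is) (sq t It).
have itt := square_integrableM measurableT (sq t It) (sq t It).
have : 0 <= \int[P]_w ((a * a) * (eps s w * eps s w) + ((- 2 * (a * b)) * (eps s w * eps t w)
    + (b * b) * (eps t w * eps t w))).
  apply: Rintegral_ge0 => w _.
  rewrite (_ : _ + _ = (a * eps s w - b * eps t w) ^+ 2); first exact: sqr_ge0.
  by ring.
have i1 := integrableZl measurableT (a * a) iss.
have i2 := integrableZl measurableT (- 2 * (a * b)) ist.
have i3 := integrableZl measurableT (b * b) itt.
rewrite (RintegralD measurableT i1 (integrableD measurableT i2 i3)).
rewrite (RintegralD measurableT i2 i3) !RintegralZl//.
rewrite -[- 2 * _ * _]mulrA /a /b !covq//; lra.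
Qed.

End oracle.

Theorem corollary3p1 (R : realType) (d : measure_display) (T : measurableType d)
  (P : probability T R) (f u v : R -> R) (eps : R -> {RV P >-> R})
  (phi : nat -> R -> R)
  (f_diff : twice_differentiable01 f)
  (u_diff : twice_differentiable01 u)
  (v_diff : twice_differentiable01 v)
  (v_neq0 : forall t, I01 t -> v t != 0)
  (eps_meas : jointly_measurable01 (fun t w => eps t w))
  (eps_gauss : gaussian_process01 eps)
  (eps_centered : centered01 eps)
  (eps_nondeg : nondegenerate01 eps)
  (eps_cov : has_covariance_kernel01 eps (triangular_kernel u v))
  (phi_basis : orthonormal_basis phi)
  (oracle_def : oracle_well_defined f u v)
  (p_int : (@lebesgue_measure R).-integrable I01 (EFin \o p_oracle f u v)) :
  let K := triangular_kernel u v in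
  let Y := fun t w => eps t w in
  let xi_star := xi_oracle (theta f phi) p_int in
  let estimator := linear_estimator P f K Y phi in
  let risk := coefficient_risk P f Y phi in
  [/\ (forall xi fhat, estimator xi fhat -> MISE P f fhat = risk xi),
      admissible f K xi_star,
      (exists fstar, estimator xi_star fstar),
      (forall xi, admissible f K xi -> (risk xi_star <= risk xi)%E) &
      forall fstar, estimator xi_star fstar ->
        [/\ forall xi fhat, estimator xi fhat ->
              (MISE P f fstar <= MISE P f fhat)%E,
            MISE P f fstar = ((1 + c_mise f u v)^-1
              * \sum_(0 <= j <oo) ((theta f phi j) ^+ 2)%:E)%E &
            MISE P f fstar = ((1 + c_mise f u v)^-1
              * \int[@lebesgue_measure R]_(t in I01) ((f t) ^+ 2)%:E)%E]].
Proof.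
move=> K Y xi_star estimator risk.
have bu := continuous_bounded_measurable01 (twice_differentiable01_continuous u_diff).1.
have bv := continuous_bounded_measurable01 (twice_differentiable01_continuous v_diff).1.
have bf := continuous_bounded_measurable01 (twice_differentiable01_continuous f_diff).1.
have I0 : I01 (0 : R) by apply/I01P; rewrite lexx ler01.
have Y_cov s t : I01 s -> I01 t -> \int[P]_w (Y s w * Y t w) = K s t.
  by move=> Is It; have := eps_cov s t Is It; rewrite unlock /Rintegral => ->.
have Y_sq t : I01 t -> square_integrable P setT (Y t).
  move=> It; split; first exact: measurable_funPT.
  apply/integrableP; split.
    by apply/measurable_EFinP/measurable_funX; exact: measurable_funPT.
  have := eps_cov t t It It; rewrite unlock => E.
  rewrite (_ : (\int[P]_w _)%E = (K t t)%:E) ?ltry// -E.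
  by apply: eq_integral => w _; rewrite /= ger0_norm ?sqr_ge0// expr2.
have Y_mean t : I01 t -> \int[P]_w Y t w = 0.
  by move=> It; have := eps_centered t It; rewrite unlock /Rintegral => ->.
have [M KM] : exists M, forall t, I01 t -> K t t <= M.
  have [_ [M uvM]] := bounded_measurable01M bu bv; exists M => t It.
  by rewrite /K /triangular_kernel lexx (le_trans (ler_norm _))// uvM.
have bK t : I01 t -> bounded_measurable01 (K ^~ t).
  exact: bounded_measurable01_triangular_kernel.
have [q_ge0 q_nd] := increasing_quotient v_neq0 Y_sq Y_cov.
pose nu : {charge set (measurableTypeR R) -> \bar R} :=
  cadd (cadd (cscale (P0_oracle f u v) (dirac_charge 0))
             (cscale (P1_oracle f u v) (dirac_charge 1))) (density_charge p_int).
have nuE g : bounded_measurable01 g -> charge_integral nu g =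
  P0_oracle f u v * g 0 + P1_oracle f u v * g 1 +
  \int[lebesgue_measure]_(t in I01) (g t * p_oracle f u v t).
  exact: charge_integral_two_atoms_density.
have [r [rE bnuK risk_nu risk_ge]] : exists r : R,
  [/\ ((1 + c_mise f u v)^-1 = r%:E)%E,
      bounded_measurable01 (fun t => charge_integral nu (fun s => K s t)),
      forall th, (th / (1 + c_oracle f u v) * charge_integral nu f - th) ^+ 2 +
        (th / (1 + c_oracle f u v)) ^+ 2 *
        charge_integral nu (fun t => charge_integral nu (fun s => K s t)) = r * th ^+ 2
    & forall xi th, r * th ^+ 2 <= estimation_risk K f xi th].
  have V_ge0 xi : 0 <= charge_integral xi (fun t => charge_integral xi (fun s => K s t)).
    exact: (variance_noise_ge0 eps_meas Y_sq Y_cov KM).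
  (* In case (C) the process has variance 0 at time 0, so that observing it
     there reveals f 0 and every theta_j is recovered without error. *)
  have [C|notC] := boolP (caseC f u).
    have /andP[/eqP u0 f0] := C.
    have p0 : p_oracle f u v = cst 0 by apply/funext => t; rewrite /p_oracle C.
    have nuC g : bounded_measurable01 g -> charge_integral nu g = (f 0)^-1 * g 0.
      move=> bg; rewrite nuE// /P0_oracle /P1_oracle C mul0r addr0.
      by rewrite /Rintegral integral0_eq ?addr0// => t _; rewrite p0 mulr0.
    have nuK t : I01 t -> charge_integral nu (fun s => K s t) = 0.
      move=> It; rewrite nuC; last exact: bK.
      by have /I01P/andP[t0 _] := It; rewrite /K /triangular_kernel t0 u0 mul0r mulr0.
    exists 0; split.
    - rewrite c_mise_caseC//; [exact: v_neq0|].
      exact: (twice_differentiable01_div v_neq0 u_diff v_diff).1.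
    - apply: eq_bounded_measurable01 (bounded_measurable01_cst 0) => t It.
      by rewrite nuK.
    - move=> th; rewrite nuC// mulVf// /c_oracle C.
      rewrite (eq_charge_integral _ (h := cst 0)) => [|t It]; last exact: nuK.
      by rewrite /charge_integral /Rintegral !integral0; field.
    - move=> xi th; rewrite mul0r addr_ge0// ?sqr_ge0//.
  have [q'0 /(_ notC) q'_neq0] := oracle_def.
  have nuK t : I01 t -> charge_integral nu (fun s => K s t) = f t.
    move=> It; rewrite nuE; last exact: bK.
    exact: (oracle_kernel_equation f_diff u_diff v_diff v_neq0 q_ge0 q_nd notC q'0 q'_neq0 p_int).
  have nuf : charge_integral nu f = c_oracle f u v.
    rewrite nuE//.
    exact: (oracle_integral_f f_diff u_diff v_diff v_neq0 q_ge0 q_nd notC q'0 q'_neq0 p_int).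
  have nuKK : charge_integral nu (fun t => charge_integral nu (fun s => K s t)) = c_oracle f u v.
    by rewrite -nuf; apply: eq_charge_integral.
  (* c_oracle is the variance of the noise integrated against nu *)
  have c0 : 0 <= c_oracle f u v by rewrite -nuKK.
  have c1 : 1 + c_oracle f u v != 0 by rewrite gt_eqF// ltr_pwDl.
  exists (1 + c_oracle f u v)^-1; split.
  - rewrite (c_miseE f_diff u_diff v_diff v_neq0 notC q'_neq0 p_int).
    by rewrite -EFinD inver (negbTE c1).
  - by apply: eq_bounded_measurable01 bf => t It; rewrite nuK.
  - by move=> th; rewrite nuKK nuf; field.
  - move=> xi th; rewrite mulrC.
    exact: (estimation_risk_ge eps_meas Y_sq Y_cov KM _ _ nuK nuf c1).
have f_L2 := bounded_measurable01_L2 bf.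
have mise xi fhat : estimator xi fhat -> MISE P f fhat = risk xi.
  exact: MISE_eq_coefficient_risk.
have risk_star := coefficient_risk_scaled phi eps_meas Y_sq Y_cov KM Y_mean bf bK bnuK risk_nu.
have risk_le := coefficient_risk_scaled_le phi eps_meas Y_sq Y_cov KM Y_mean bf bK bnuK risk_nu risk_ge.
split.
- exact: mise.
- exact: (admissible_scaled eps_meas Y_sq Y_cov KM phi_basis bf bK (c_oracle f u v) bnuK).
- exact: (exists_scaled_estimator eps_meas Y_sq Y_cov KM phi_basis bf bK (c_oracle f u v) bnuK).
- by move=> xi _; exact: risk_le.
- move=> fstar Efstar; rewrite (mise _ _ Efstar) rE; split.
  + by move=> xi fhat /mise ->; exact: risk_le.
  + exact: risk_star.
  + by rewrite (parseval phi_basis bf.1 (cvg_theta phi_basis f_L2)); exact: risk_star.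
Qed.
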